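(* Let $\lambda>3$, let $\mu_\lambda$ be the Pareto probability measure on $[1,\infty)$ with density $(\lambda-1)x^{-\lambda}$, and let $\mu_\lambda^n$ be its $n$-fold product on $\mathbb{R}^n$. Then for every $1$-Lipschitz function $f:\mathbb{R}^n\to\mathbb{R}$, $$\operatorname{Var}_{\mu_\lambda^n}(f)\le C(\lambda)\,n^{\frac{2}{\lambda-1}},\qquad C(\lambda)=2^{\frac{6\lambda-16}{\lambda-1}}(\lambda-1)^{-\frac{2\lambda-6}{\lambda}}\left(\frac{4}{\lambda-3}\right)^{\frac{2}{\lambda-1}}.$$ Therefore $$\sup_{f\in\operatorname{Lip}_1(\mathbb{R}^n)}\operatorname{Var}_{\mu_\lambda^n}(f)=\Theta\left(n^{\frac{2}{\lambda-1}}\right).$$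
   Context: $\operatorname{Lip}_1(\mathbb{R}^n)$ is the set of $1$-Lipschitz functions $f:\mathbb{R}^n\to\mathbb{R}$, i.e. $|f(x)-f(y)|\le|x-y|_2$ for all $x,y$ (Euclidean norm). $\operatorname{Var}_\nu(f)=\mathbb{E}_\nu[f^2]-(\mathbb{E}_\nu[f])^2$. $\Theta$ is as $n\to\infty$ with $\lambda$ fixed. *)

(* Defs.v *)
From HB Require Import structures.
From mathcomp Require Import all_boot all_order all_algebra.
From mathcomp Require Import interval_inference.
From mathcomp Require Import all_classical all_reals all_analysis.
From mathcomp Require Import measurable_realfun.

Set Implicit Arguments.
Unset Strict Implicit.
Unset Printing Implicit Defensive.

Import Order.TTheory GRing.Theory Num.Theory.
Import numFieldNormedType.Exports.

Local Open Scope classical_set_scope.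
Local Open Scope ring_scope.

Section product_probability.
Context d1 d2 (T1 : measurableType d1) (T2 : measurableType d2) (R : realType).
Variables (P1 : probability T1 R) (P2 : probability T2 R).

Let prod := (P1 \x P2)%E.

HB.instance Definition _ := Measure.on prod.

Let prod_setT : prod [set: T1 * T2] = 1%E.
Proof.
rewrite -setXTT [LHS]product_measure1E// -[RHS]mule1.
by congr (_ * _)%E; exact: probability_setT.
Qed.

HB.instance Definition _ := Measure_isProbability.Build _ _ _ prod prod_setT.

Definition product_probability : probability (T1 * T2)%type R := prod.

End product_probability.

Section power_probability.
Context d (T : measurableType d) (R : realType) (P : probability T R).

Definition tuple_cons n (x : T * n.-tuple T) : n.+1.-tuple T :=
  [tuple of x.1 :: x.2].

Let measurable_tuple_cons n : measurable_fun [set: T * n.-tuple T] (@tuple_cons n).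
Proof. exact: measurable_cons. Qed.

HB.instance Definition _ n := isMeasurableFun.Build _ _ _ _ (@tuple_cons n)
  (@measurable_tuple_cons n).

(* The n-fold product measure; see [power_probability_box] for its values on
   measurable boxes, which determine it. *)
Fixpoint power_probability n : probability (n.-tuple T) R :=
  match n with
  | 0 => dirac [tuple]
  | n'.+1 =>
      distribution (product_probability P (power_probability n'))
        (@tuple_cons n')
  end.

Lemma power_probability_box n (A : 'I_n -> set T) :
  (forall i, measurable (A i)) ->
  power_probability n [set x | forall i, A i (tnth x i)] =
  (\prod_(i < n) P (A i))%E.
Proof.
elim: n A => [|n IH] A mA.
  by rewrite big_ord0 /= diracE mem_set// => -[].
rewrite big_ord_recl -(IH (fun i => A (lift ord0 i)))//= /distribution.
rewrite /pushforward -product_measure1E//; last first.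
  rewrite (_ : [set x | _] =
      \bigcap_(i in [set: 'I_n]) ((@tnth n T)^~ i @^-1` A (lift ord0 i))).
    apply: fin_bigcap_measurable => [|i _]; first exact: finite_finset.
    by rewrite -[X in measurable X]setTI; exact: measurable_tnth.
  by apply/seteqP; split=> x /= h i => [_|]; [exact: h|exact: (h i I)].
congr (_ _); apply/seteqP; split=> -[x y] /=.
  move=> h; split; first exact: (h ord0).
  by move=> i; have := h (lift ord0 i); rewrite tnthS.
move=> [Ax Ay] i; case: (unliftP ord0 i) => [j|] ->//=.
by rewrite tnthS; exact: Ay.
Qed.

End power_probability.

Section pareto.
Context {R : realType}.
Notation mu := lebesgue_measure.

Definition pareto_pdf (lambda : R) : R -> R :=
  (fun x => (lambda - 1) * x `^ (- lambda)) \_ `[1, +oo[.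

Definition pareto_prob (lambda : R) : set (measurableTypeR R) -> \bar R :=
  fun V => (\int[mu]_(x in V) (pareto_pdf lambda x)%:E)%E.

Variable lambda : R.
Hypothesis lambda_gt1 : 1 < lambda.

Lemma pareto_pdf_ge0 x : 0 <= pareto_pdf lambda x.
Proof.
apply: restrict_ge0 => {}x _.
by rewrite mulr_ge0 ?powR_ge0// subr_ge0 ltW.
Qed.

Lemma measurable_pareto_pdf : measurable_fun [set: R] (pareto_pdf lambda).
Proof.
apply/measurable_restrict => //; apply: measurable_funTS.
by apply: measurable_funM => //; exact: measurable_powR.
Qed.

Let F x : R := - x `^ (1 - lambda).

Let is_derive_F (x : R) : 0 < x ->
  is_derive x 1 F ((lambda - 1) * x `^ (- lambda)).
Proof.
move=> x0; have := is_deriveN (is_derive1_powR (1 - lambda) x0).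
by rewrite -mulNr opprB addrAC subrr add0r.
Qed.

Lemma integral_pareto_pdf : (\int[mu]_x (pareto_pdf lambda x)%:E = 1)%E.
Proof.
have cpow a (x : R) : 0 < x -> {for x, continuous (@powR R ^~ a)}.
  move=> x0; apply/differentiable_continuous/derivable1_diffP.
  exact: (@ex_derive _ _ _ _ _ _ _ (is_derive1_powR a x0)).
transitivity
    (\int[mu]_(x in `[1%R, +oo[) ((lambda - 1) * x `^ (- lambda))%:E)%E.
  rewrite [RHS]integral_mkcond; apply: eq_integral => x _.
  by rewrite /pareto_pdf !patchE; case: ifP.
rewrite (@ge0_continuous_FTC2y _ _ F 1 0)//.
- by rewrite /F powR1 EFinN oppeK add0e.
- by move=> x _; rewrite mulr_ge0 ?powR_ge0// subr_ge0 ltW.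
- apply: continuous_in_subspaceT => x; rewrite inE/= in_itv/= andbT => x1.
  apply: (@continuousM _ R^o (fun=> lambda - 1) (fun y => y `^ (- lambda))).
    exact: cst_continuous.
  by apply: cpow; exact: lt_le_trans x1.
- rewrite -oppr0; apply: cvgN.
  apply/cvgr0Pnorm_lt => e e0; near=> x.
  have x0 : 0 < x by [].
  have l1 : 0 < lambda - 1 by rewrite subr_gt0.
  rewrite ger0_norm ?powR_ge0// -[1 - _]opprB powRN invf_plt ?posrE ?powR_gt0//.
  have -> : e^-1 = (e^-1 `^ (lambda - 1)^-1) `^ (lambda - 1).
    by rewrite -powRrM mulVf ?gt_eqF// powRr1// invr_ge0 ltW.
  apply: gt0_ltr_powR; rewrite ?nnegrE ?powR_ge0 ?(ltW x0)//.
- by move=> x x1; apply: ex_derive; apply: is_derive_F; exact: lt_trans x1.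
- apply: cvg_at_right_filter; apply: cvgN; exact: cpow.
- move=> x; rewrite in_itv/= andbT => x1.
  by rewrite derive1E; apply: derive_val; apply: is_derive_F; exact: lt_trans x1.
Unshelve. all: by end_near. Qed.

Let pareto0 : pareto_prob lambda set0 = 0%E.
Proof. by rewrite /pareto_prob integral_set0. Qed.

Let pareto_ge0 A : (0 <= pareto_prob lambda A)%E.
Proof. by apply: integral_ge0 => x _; rewrite lee_fin pareto_pdf_ge0. Qed.

Let pareto_sigma_additive : semi_sigma_additive (pareto_prob lambda).
Proof.
move=> /= A mA tA mUA; rewrite /pareto_prob; apply: cvg_toP.
  apply: ereal_nondecreasing_is_cvgn => m n mn.
  apply: lee_sum_nneg_natr => // k _ _; apply: integral_ge0 => /= x _.
  by rewrite lee_fin pareto_pdf_ge0.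
rewrite ge0_integral_bigcup//=.
- by apply/measurable_funTS/measurableT_comp => //; exact: measurable_pareto_pdf.
- by move=> x _; rewrite lee_fin pareto_pdf_ge0.
Qed.

HB.instance Definition _ := isMeasure.Build _ _ _
  (pareto_prob lambda) pareto0 pareto_ge0 pareto_sigma_additive.

Let pareto_setT : pareto_prob lambda [set: R] = 1%E.
Proof. exact: integral_pareto_pdf. Qed.

HB.instance Definition _ :=
  @Measure_isProbability.Build _ _ R (pareto_prob lambda) pareto_setT.

Definition pareto_probability : probability (measurableTypeR R) R :=
  pareto_prob lambda.

End pareto.

Definition pareto_power {R : realType} (lambda : R) (lambda_gt1 : 1 < lambda) n :
    probability (n.-tuple (measurableTypeR R)) R :=
  power_probability (pareto_probability lambda_gt1) n.

Definition euclidean_dist {R : realType} {n} (x y : n.-tuple R) : R :=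
  Num.sqrt (\sum_(i < n) (tnth x i - tnth y i) ^+ 2).

Definition Lip1 {R : realType} n : set (n.-tuple R -> R) :=
  [set f | forall x y, `|f x - f y| <= euclidean_dist x y].
Arguments Lip1 {R} n.

Definition pareto_constant {R : realType} (lambda : R) : R :=
  2 `^ ((6 * lambda - 16) / (lambda - 1)) *
  (lambda - 1) `^ (- ((2 * lambda - 6) / lambda)) *
  (4 / (lambda - 3)) `^ (2 / (lambda - 1)).

Lemma gt3_gt1 {R : realType} (lambda : R) : 3 < lambda -> 1 < lambda.
Proof. by apply: lt_trans; rewrite ltr1n. Qed.

(* Variance in the sense of the library: ['V_P[f]] is E[(f - E f)^2] in the
   extended reals, hence +oo when f is measurable and not square-integrable;
   it is E[f^2] - (E f)^2 when f is square-integrable, by [varianceE]. *)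
Definition sup_variance {R : realType} (lambda : R) (lambda_gt1 : 1 < lambda) n
    : \bar R :=
  ereal_sup [set 'V_(pareto_power lambda_gt1 n)[f] | f in Lip1 n]%E.

(* Main.v *)
Require Import Defs.
From HB Require Import structures.
From mathcomp Require Import all_boot all_order all_algebra.
From mathcomp Require Import interval_inference.
From mathcomp Require Import all_classical all_reals all_analysis.
From mathcomp Require Import measurable_realfun ring lra.

(** Write alpha = lambda - 1. In dimension one, integrating by parts the square
    of a function vanishing at 1 gives the weighted Poincare inequality
    Var g <= (4 / alpha^2) E[x^2 g'(x)^2], which tensorizes over coordinates.
    A 1-Lipschitz function need not be differentiable, so it is first averaged
    over [x_j, x_j + e] in each coordinate j; the averaged function has
    Lipschitz partial derivatives p_i, with \sum_i p_i^2 <= 1. Splitting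
    x_i^2 p_i^2 at the threshold t = n^(1/alpha),
    \sum_i x_i^2 p_i^2 <= t^2 + \sum_i x_i^2 1_{x_i >= t},
    whose expectation is of order n^(2/alpha); the constant obtained this way
    is smaller than C(lambda). For the lower bound take the maximum of the
    coordinates: it is below (2 n)^(1/alpha) and above (4 n)^(1/alpha), each
    with probability bounded away from 0. *)

Set Implicit Arguments.
Unset Strict Implicit.
Unset Printing Implicit Defensive.

Import Order.TTheory GRing.Theory Num.Theory.
Import numFieldNormedType.Exports.

Local Open Scope classical_set_scope.
Local Open Scope ring_scope.

(** * The constant *)

(** The obstacle is regularity: derivatives have to survive averaging and integration over the other
    coordinates. They are therefore encoded by a uniform quadratic Taylor bound, [partial_with],
    which can be averaged and integrated as an inequality, with no differentiation under the
    integral. Its constant [L] blows up as the smoothing scale tends to 0 but never enters the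
    Poincare inequality, so the scale can be sent to 0 at the end. In dimension one the function is
    centred at its value at 1 instead of its mean: this only increases the second moment, and it
    makes the boundary term of the integration by parts have a favourable sign. The threshold t is
    the typical size of the largest coordinate, since n P(x_i >= t) = n t^(-alpha) = 1. At that
    scale t^2 and the sum of the n tail second moments have the same order, which is also why the
    maximum is an extremal example. The variance takes extended real values, so square integrability
    of Lipschitz functions, which comes from lambda > 3, has to be established before a variance is
    expanded. *)

Lemma ln_le_subr1 {R : realType} (x : R) : 0 < x -> ln x <= x - 1.
Proof.
move=> x0; rewrite -[leRHS]expRK ler_ln ?posrE ?expR_gt0//.
by have := expR_ge1Dx (x - 1); rewrite addrCA subrr addr0.
Qed.

Lemma ln_ge_1BV {R : realType} (x : R) : 0 < x -> 1 - x^-1 <= ln x.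
Proof.
move=> x0; have := @ln_le_subr1 R x^-1; rewrite invr_gt0 lnV ?posrE// => /(_ x0).
by rewrite lerNl opprB.
Qed.

(** With u = lambda - 3, this is what remains of [pareto_constant_ge] after taking logarithms,
    multiplying by u + 2 and enlarging u (u + 2) / (u + 3), which multiplies ln (u + 2) with a
    negative sign, to u. *)
Lemma log_constant_bound {R : realType} (u : R) : 0 < u ->
  (u + 2) * ln (u + 1) <= (2 * u - 2) * ln 2 + 4 * ln (u + 2) + u * ln u.
Proof.
move=> u0.
have l2 : (2^-1 : R) <= ln 2.
  by apply: le_trans (ln_ge_1BV _) => //; lra.
(* For u >= 1, u + 1 <= 2 u controls u ln (u + 1). For u < 1, the negative term u ln u is at least u
   - 1, and 4 (u + 1) <= (u + 2)^2 together with ln 2 >= 1/2 compensates it. *)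
have [u1|u1] := leP 1 u.
- have h1 : ln (u + 1) <= ln 2 + ln u.
    by rewrite -lnM ?posrE// ler_ln ?posrE//; nra.
  have h2 : ln (u + 1) <= ln (u + 2) by rewrite ler_ln ?posrE//; lra.
  have h3 : ln 2 <= ln (u + 2) by rewrite ler_ln ?posrE//; lra.
  nra.
- have h1 : ln (u + 1) <= ln 2 by rewrite ler_ln ?posrE//; lra.
  have h2 : ln (u + 1) + 2 * ln 2 <= 2 * ln (u + 2).
    have p1 : 0 < u + 1 by lra.
    have p2 : 0 < u + 2 by lra.
    rewrite !mulr_natl -!lnXn// -lnM ?posrE ?exprn_gt0//.
    by rewrite ler_ln ?posrE ?mulr_gt0 ?exprn_gt0//; nra.
  have h3 : u - 1 <= u * ln u.
    have := ln_ge_1BV u0; rewrite -(ler_pM2l u0) mulrBr mulfV ?gt_eqF//.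
    by rewrite mulr1.
  nra.
Qed.

(** The left side is the constant of [variance_Lip1_le]: 4 / (lambda - 1)^2 from the Poincare
    inequality, 2 (lambda - 2) / (lambda - 3) from the splitting at t, and a factor 2 from replacing
    f by its average. *)
Lemma pareto_constant_ge {R : realType} (lambda : R) : 3 < lambda ->
  16 * (lambda - 2) / ((lambda - 1) ^+ 2 * (lambda - 3))
  <= pareto_constant lambda.
Proof.
move=> l3.
have [u u0 ->] : exists2 u, 0 < u & lambda = u + 3.
  by exists (lambda - 3); [rewrite subr_gt0|rewrite subrK].
have h := log_constant_bound u0.
rewrite /pareto_constant.
have -> : u + 3 - 1 = u + 2 by ring.
have -> : u + 3 - 2 = u + 1 by ring.
have -> : u + 3 - 3 = u by ring.
have a0 : 0 < u + 2 by rewrite addr_gt0.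
have b0 : 0 < u + 1 by rewrite addr_gt0.
rewrite -[leLHS]lnK ?posrE ?divr_gt0 ?mulr_gt0 ?exprn_gt0//.
rewrite -[leRHS]lnK ?posrE ?mulr_gt0 ?powR_gt0 ?divr_gt0//.
rewrite ler_expR ln_div ?posrE ?mulr_gt0 ?exprn_gt0//.
rewrite !lnM ?posrE ?mulr_gt0 ?powR_gt0 ?divr_gt0 ?exprn_gt0//.
rewrite !ln_powR ln_div ?posrE//.
have -> : ln (16 : R) = 4 * ln 2.
  by rewrite mulr_natl -lnXn//; congr ln; lra.
have -> : ln (4 : R) = 2 * ln 2.
  by rewrite mulr_natl -lnXn//; congr ln; lra.
rewrite -(ler_pM2l a0).
set la := ln (u + 2); set l2 := ln 2; set lu := ln u; set lb := ln (u + 1).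
have la0 : 0 <= la by rewrite /la ln_ge0//; lra.
have -> : (u + 2) * ((6 * (u + 3) - 16) / (u + 2) * l2 +
        - ((2 * (u + 3) - 6) / (u + 3)) * la + 2 / (u + 2) * (2 * l2 - lu)) =
  (6 * u + 6) * l2 - 2 * lu - 2 * (u * (u + 2) / (u + 3)) * la.
  by field; rewrite !gt_eqF//; lra.
have h1 : u * (u + 2) / (u + 3) <= u.
  by rewrite ler_pdivrMr ?ler_pM2l//; lra.
have h3 : u * (u + 2) / (u + 3) * la <= u * la by rewrite ler_wpM2r.
rewrite -/lb -/l2 -/la -/lu in h.
lra.
Qed.

(** * Averages of Lipschitz functions of a real variable *)

Section primitive.
Context {R : realType}.
Notation mu := lebesgue_measure.
Implicit Types (F G h : R -> R) (a b x : R).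

Lemma mvt_between G h a b :
  (forall z, Num.min a b <= z <= Num.max a b -> is_derive z 1 G (h z)) ->
  exists2 c, Num.min a b <= c <= Num.max a b & G b - G a = h c * (b - a).
Proof.
wlog ab : a b / a <= b.
  move=> H dG; have /orP[ab|ba] := le_total a b; first exact: H.
  rewrite minC maxC; have [|c cab Gc] := H b a ba.
    by move=> z; rewrite minC maxC; exact: dG.
  exists c => //.
  by rewrite -[LHS]opprB Gc -mulrN opprB.
rewrite min_l// max_r// => dG.
have [] := @MVT_segment R G h a b ab.
- by move=> x; rewrite in_itv/= => /andP[/ltW ax /ltW xb]; apply: dG; rewrite ax.
- apply: derivable_within_continuous => x; rewrite in_itv/= => xab.
  exact: @ex_derive _ _ _ _ _ _ _ (dG _ xab).
by move=> c; rewrite in_itv/=; exists c.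
Qed.

Lemma local_primitive h a x : continuous h -> a < x ->
  is_derive x 1 (fun y => \int[mu]_(t in `[a, y]) h t) (h x).
Proof.
move=> ch ax; have xx1 : x < x + 1 by rewrite ltrDl.
have ih : mu.-integrable `[a, x + 1] (EFin \o h).
  apply: continuous_compact_integrable; first exact: segment_compact.
  exact: continuous_subspaceT.
have [dF F'] := @continuous_FTC1_closed _ _ _ _ _ xx1 ih ax (ch x).
by apply: DeriveDef => //; rewrite -derive1E.
Qed.

(** An integral from a fixed base point is a primitive only to the right of it. The integrals from
    -n, normalised to vanish at 0, agree wherever two of them apply, because their difference has
    derivative 0; they are glued by choosing n larger than |x|. *)
Lemma continuous_primitive h : continuous h ->
  exists F, forall x, is_derive x 1 F (h x).
Proof.
move=> ch.
pose F (n : nat) (x : R) := \int[mu]_(t in `[- n%:R, x]) h t.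
have FE m n x : `|x| < m%:R -> `|x| < n%:R -> F m x - F m 0 = F n x - F n 0.
  move=> xm xn.
  have [|c _] := @mvt_between (F m \- F n) (h \- h) 0 x.
    move=> z /andP[z1 _]; have {}z1 : - `|x| <= z.
      by apply: le_trans z1; rewrite le_min oppr_le0 normr_ge0 lerNl ler_normr lexx orbT.
    by apply: is_deriveB; apply: local_primitive => //;
      apply: lt_le_trans z1; rewrite ltrN2.
  rewrite /= subrr mul0r => FF; lra.
pose N x := (Num.trunc `|x|).+1.
have NP x : `|x| < (N x)%:R by rewrite truncnS_gt.
exists (fun x => F (N x) x - F (N x) 0) => x.
pose k := (N x).+1.
have kx : `|x| + 1 < k%:R by rewrite -natr1 ltrD2r.
apply: (@near_eq_is_derive _ _ _ (fun y => F k y - F k 0)).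
  have nx : \forall y \near x, `|x - y| < 1.
    exact: (nbhsx_ballx x 1 ltr01).
  near=> y; have yx : `|x - y| < 1 by near: y.
  apply: FE => //; apply: le_lt_trans kx.
  by rewrite -[y](subrK x) addrC (le_trans (ler_normD _ _))// lerD2l distrC ltW.
rewrite -[X in is_derive _ _ _ X]subr0; apply: is_deriveB.
apply: local_primitive => //; rewrite ltrNl.
apply: le_lt_trans kx; rewrite (le_trans (ler_norm _))// normrN lerDl//.
Unshelve. all: by end_near. Qed.

End primitive.

Section mean.
Context {R : realType}.
Implicit Types (F G h : R -> R) (a b c e x K : R).

Lemma lip_continuous K h : (forall x y, `|h x - h y| <= K * `|x - y|) ->
  continuous h.
Proof.
move=> hK x; apply/cvgrPdist_le => /= e e0.
have K1 : 0 < `|K| + 1 by rewrite ltr_wpDl.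
near=> y; apply: le_trans (hK _ _) _.
have xy : `|x - y| < e / (`|K| + 1).
  by near: y; apply: (nbhsx_ballx x (e / (`|K| + 1))); rewrite divr_gt0.
apply: (@le_trans _ _ ((`|K| + 1) * `|x - y|)).
  by rewrite ler_wpM2r// (le_trans (ler_norm _))// lerDl.
by rewrite mulrC -ler_pdivlMr// ltW.
Unshelve. all: by end_near. Qed.

Definition primitive h : R -> R :=
  xget (fun=> 0) [set F : R -> R | forall x, is_derive x 1 F (h x)].

Lemma primitiveP h x : continuous h -> is_derive x 1 (primitive h) (h x).
Proof.
by move=> /continuous_primitive[F dF]; rewrite /primitive; case: xgetP => [G _|/(_ F)].
Qed.

(** For continuous [h] and e > 0 this is the average of [h] over [0, e]. As an increment of a
    primitive it is accessible to the mean value theorem alone. *)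
Definition mean e h : R := (primitive h e - primitive h 0) / e.

(** The combination of averages is the increment quotient of one function, hence equals the
    combination of [h1], [h2], [h3] at a single point. With a = 0 it transfers moduli of continuity,
    with a an increment it transfers Taylor bounds. *)
Lemma mean_near e h1 h2 h3 a c : 0 < e ->
  continuous h1 -> continuous h2 -> continuous h3 ->
  (forall s, 0 <= s <= e -> `|h1 s - h2 s - a * h3 s| <= c) ->
  `|mean e h1 - mean e h2 - a * mean e h3| <= c.
Proof.
move=> e0 c1 c2 c3 hc.
have [z _|z] := @mvt_between R
  (primitive h1 \- primitive h2 \- a \*: primitive h3)
  (h1 \- h2 \- (fun s => a * h3 s)) 0 e.
  by apply: is_deriveB; [apply: is_deriveB|apply: is_deriveZ]; exact: primitiveP.
rewrite min_l ?max_r ?(ltW e0)// => ze; rewrite subr0 /= => E.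
rewrite /mean [X in `|X|](_ : _ = h1 z - h2 z - a * h3 z); last first.
  apply: (mulIf (lt0r_neq0 e0)); rewrite -E /GRing.scale/=; field; exact: lt0r_neq0.
exact: hc.
Qed.

Lemma mean_cst e c : 0 < e -> mean e (fun=> c) = c.
Proof.
move=> e0; rewrite /mean.
have [z _|z _] := @mvt_between R (primitive (fun=> c)) (fun=> c) 0 e.
  by apply: primitiveP => x; exact: cst_continuous.
by rewrite subr0 => ->; rewrite mulfK// gt_eqF.
Qed.

Lemma primitive_taylor K h G a t : 0 <= K ->
  (forall x y, `|h x - h y| <= K * `|x - y|) ->
  (forall x, is_derive x 1 G (h x)) ->
  `|G (t + a) - G t - a * h t| <= K * a ^+ 2.
Proof.
move=> K0 hK dG; have [z zt ->] := @mvt_between R G h t (t + a) (fun z _ => dG z).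
rewrite addrAC subrr add0r [a * _]mulrC -mulrBl normrM -real_normK ?num_real//.
rewrite expr2 mulrA ler_wpM2r// (le_trans (hK _ _))// ler_wpM2l//.
move: zt => /andP[]; have [a0|a0] := leP 0 a.
  by rewrite min_l ?max_r ?lerDl// => t1 t2; rewrite (ger0_norm a0) ger0_norm ?subr_ge0// lerBlDl.
rewrite min_r ?max_l ?gerDl ?(ltW a0)// => t1 t2.
by rewrite (ltr0_norm a0) ler0_norm ?subr_le0// opprB; lra.
Qed.

(** The average over [a, a + e] is (G (e + a) - G a) / e for a primitive G of [h]. Expanding G at e
    and at 0 gives the difference quotient as derivative in a, with an error K a^2 at each of the
    two points. *)
Lemma mean_shift K e h a : 0 <= K -> 0 < e ->
  (forall x y, `|h x - h y| <= K * `|x - y|) ->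
  `|mean e (fun s => h (s + a)) - mean e h - a * ((h e - h 0) / e)|
  <= 2 * K / e * a ^+ 2.
Proof.
move=> K0 e0 hK; have ch := lip_continuous hK.
pose G := primitive h.
have -> : mean e (fun s => h (s + a)) = (G (e + a) - G a) / e.
  rewrite /mean; congr (_ / _); apply/eqP; rewrite -subr_eq0.
  have cha : continuous (fun s => h (s + a)).
    by apply: (@lip_continuous K) => x y; rewrite (le_trans (hK _ _))// opprD addrACA subrr addr0.
  have [z _|z _] := @mvt_between R
    (primitive (fun s => h (s + a)) \- (G \o shift a))
    ((fun s => h (s + a)) \- (fun s => h (s + a))) 0 e.
    apply: is_deriveB; first exact: primitiveP.
    rewrite -[X in is_derive _ _ _ X]mulr1.
    apply: (@is_derive1_comp _ _ (shift a)); first exact: (primitiveP _ ch).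
    exact: is_derive_shift.
  by rewrite /= subrr mul0r add0r => E; apply/eqP; lra.
have h1 := @primitive_taylor K h G a e K0 hK (fun x => primitiveP x ch).
have h2 := @primitive_taylor K h G a 0 K0 hK (fun x => primitiveP x ch).
rewrite add0r in h2.
rewrite /mean -/G [X in `|X|](_ : _ =
  ((G (e + a) - G e - a * h e) - (G a - G 0 - a * h 0)) / e); last by field; exact: lt0r_neq0.
rewrite normrM normfV (gtr0_norm e0) [leRHS]mulrAC ler_wpM2r ?invr_ge0 ?(ltW e0)//.
rewrite (le_trans (ler_normB _ _))//.
by apply: le_trans (lerD h1 h2) _; rewrite -mulrDl mulr_natl mulr2n.
Qed.

End mean.

(** * Coordinatewise smoothing of Lipschitz functions *)

Section smoothing.
Context {R : realType} {n : nat}.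
Implicit Types (x y : n.-tuple R) (i j : 'I_n) (f g p : n.-tuple R -> R).
Implicit Types (a b e L K : R).

Definition tshift i a x : n.-tuple R :=
  [tuple tnth x j + (if j == i then a else 0) | j < n].

Definition dist1 x y : R := \sum_(i < n) `|tnth x i - tnth y i|.

(* Lipschitz for the l^1 distance, unlike [Lip1], which is Euclidean. *)
Definition lip1 L f := forall x y, `|f x - f y| <= L * dist1 x y.

(* A quantitative form of being the i-th partial derivative of f that is
   stable under averaging, unlike differentiability at a point. *)
Definition partial_with L i f p :=
  forall x a, `|f (tshift i a x) - f x - a * p x| <= L * a ^+ 2.

Definition smooth e i f x : R := mean e (fun s => f (tshift i s x)).

Lemma tshift0 i x : tshift i 0 x = x.
Proof. by apply: eq_from_tnth => j; rewrite tnth_mktuple if_same addr0. Qed.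

Lemma tshiftD i a b x : tshift i a (tshift i b x) = tshift i (b + a) x.
Proof.
by apply: eq_from_tnth => j; rewrite !tnth_mktuple -addrA; case: ifP; rewrite ?addr0.
Qed.

Lemma tshiftC i j a b x : tshift i a (tshift j b x) = tshift j b (tshift i a x).
Proof. by apply: eq_from_tnth => k; rewrite !tnth_mktuple addrAC. Qed.

Lemma dist1_ge0 x y : 0 <= dist1 x y. Proof. exact: sumr_ge0. Qed.

Lemma dist1_tshift i a x y : dist1 (tshift i a x) (tshift i a y) = dist1 x y.
Proof.
by apply: eq_bigr => j _; rewrite !tnth_mktuple opprD addrACA subrr addr0.
Qed.

Lemma dist1_tshiftB i a b x : dist1 (tshift i a x) (tshift i b x) = `|a - b|.
Proof.
rewrite /dist1 (bigD1 i)//= !tnth_mktuple eqxx big1 ?addr0.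
  by rewrite opprD addrACA subrr add0r.
by move=> j /negPf ji; rewrite !tnth_mktuple ji subrr normr0.
Qed.

Lemma euclidean_dist_tshift i a x y :
  euclidean_dist (tshift i a x) (tshift i a y) = euclidean_dist x y.
Proof.
congr Num.sqrt.
by apply: eq_bigr => j _; rewrite !tnth_mktuple opprD addrACA subrr addr0.
Qed.

Lemma euclidean_dist_le1 x y : euclidean_dist x y <= dist1 x y.
Proof.
rewrite -(ger0_norm (dist1_ge0 x y)) -sqrtr_sqr ler_wsqrtr// expr2 mulr_suml.
apply: ler_sum => i _; rewrite -real_normK ?num_real// expr2 ler_wpM2l//.
by rewrite /dist1 (bigD1 i)//= lerDl sumr_ge0.
Qed.

Lemma Lip1_lip1 f : Lip1 n f -> lip1 1 f.
Proof.
by move=> fL x y; rewrite mul1r (le_trans (fL x y))// euclidean_dist_le1.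
Qed.

Lemma slice_lip L i f x : lip1 L f -> forall s t : R,
  `|f (tshift i s x) - f (tshift i t x)| <= L * `|s - t|.
Proof. by move=> fL s t; rewrite (le_trans (fL _ _))// dist1_tshiftB. Qed.

Lemma slice_continuous L i f x : lip1 L f ->
  continuous (fun s : R => f (tshift i s x)).
Proof. by move=> fL; apply: lip_continuous => s t; exact: slice_lip. Qed.

(** [D] is kept general because the Euclidean distance (for the gradient bound) and [dist1] (for the
    regularity of the partial derivatives) must both be preserved by averaging. *)
Lemma smooth_modulus (D : n.-tuple R -> n.-tuple R -> R) L e i f : 0 < e ->
  (forall x y a, D (tshift i a x) (tshift i a y) = D x y) -> lip1 L f ->
  (forall x y, `|f x - f y| <= D x y) ->
  forall x y, `|smooth e i f x - smooth e i f y| <= D x y.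
Proof.
move=> e0 DE fL fD x y; rewrite -[X in `|X|]subr0 -(mul0r (mean e (fun=> 0))).
apply: mean_near => //; try exact: slice_continuous fL.
  by move=> z; exact: cst_continuous.
by move=> s _; rewrite mul0r subr0 (le_trans (fD _ _))// DE.
Qed.

Lemma smooth_Lip1 e i f : 0 < e -> Lip1 n f -> Lip1 n (smooth e i f).
Proof.
move=> e0 fL; apply: smooth_modulus (Lip1_lip1 fL) fL => // *.
exact: euclidean_dist_tshift.
Qed.

Lemma smooth_lip1 L e i f : 0 < e -> lip1 L f -> lip1 L (smooth e i f).
Proof.
move=> e0 fL; apply: smooth_modulus (fL) fL => // *.
by rewrite dist1_tshift.
Qed.

Lemma smooth_dist e i f x : 0 < e -> lip1 1 f -> `|smooth e i f x - f x| <= e.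
Proof.
move=> e0 fL; rewrite -[X in `|X|]subr0 -(mul0r (mean e (fun=> 0))).
rewrite -[X in _ - X - _](mean_cst _ e0); apply: mean_near => //.
- exact: slice_continuous fL.
- by move=> z; exact: cst_continuous.
- by move=> z; exact: cst_continuous.
move=> s /andP[s0 se]; rewrite mul0r subr0 -{2}(tshift0 i x).
by rewrite (le_trans (slice_lip _ _ fL _ _))// subr0 mul1r ger0_norm.
Qed.

(** Translations along i and j commute, so the Taylor bound in direction j is averaged along i as it
    stands. *)
Lemma smooth_partial L K e i j f p : 0 < e -> lip1 K f -> lip1 L p ->
  partial_with L j f p -> partial_with L j (smooth e i f) (smooth e i p).
Proof.
move=> e0 fK pL fp x a; rewrite /smooth; apply: mean_near => //.
- exact: slice_continuous fK.
- exact: slice_continuous fK.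
- exact: slice_continuous pL.
by move=> s _; rewrite tshiftC; exact: fp.
Qed.

Definition diff_quotient e i f x : R := (f (tshift i e x) - f x) / e.

Lemma diff_quotient_lip1 K e i f : 0 < e -> lip1 K f ->
  lip1 (2 * K / e) (diff_quotient e i f).
Proof.
move=> e0 fK x y; rewrite /diff_quotient -mulrBl normrM normfV (gtr0_norm e0).
rewrite [leRHS]mulrAC ler_wpM2r ?invr_ge0 ?(ltW e0)//.
have h1 := fK (tshift i e x) (tshift i e y); rewrite dist1_tshift in h1.
rewrite [X in `|X|](_ : _ = (f (tshift i e x) - f (tshift i e y)) - (f x - f y)).
  by apply: le_trans (ler_normB _ _) _; have := fK x y; lra.
by ring.
Qed.

(** Averaging along i creates the i-th partial derivative: the derivative of a moving average is the
    difference quotient across the window. *)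
Lemma smooth_partial_self K e i f : 0 <= K -> 0 < e -> lip1 K f ->
  partial_with (2 * K / e) i (smooth e i f) (diff_quotient e i f).
Proof.
move=> K0 e0 fK x a; have := mean_shift a K0 e0 (slice_lip i x fK).
rewrite tshift0 /smooth; congr (`|mean _ _ - _ - _| <= _).
by apply/funext => s; rewrite tshiftD addrC.
Qed.

Lemma lip1W L K f : L <= K -> lip1 L f -> lip1 K f.
Proof.
by move=> LK fL x y; rewrite (le_trans (fL _ _))// ler_wpM2r ?dist1_ge0.
Qed.

Lemma partial_withW L K i f p : L <= K -> partial_with L i f p ->
  partial_with K i f p.
Proof.
by move=> LK fp x a; rewrite (le_trans (fp _ _))// ler_wpM2r ?sqr_ge0.
Qed.

(** Induction on the number k of coordinates already averaged: the next average moves the function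
    by at most e, creates the partial derivative in its own direction and preserves the earlier
    ones, at the cost of adding 2 / e to [L]. *)
Lemma smooth_approximation e f : 0 < e -> Lip1 n f ->
  exists g (p : 'I_n -> n.-tuple R -> R) L,
  [/\ Lip1 n g, forall x, `|g x - f x| <= n%:R * e, 0 <= L &
      forall i, lip1 L (p i) /\ partial_with L i g (p i)].
Proof.
move=> e0 fL.
suff : forall k, (k <= n)%N -> exists g (p : 'I_n -> n.-tuple R -> R) L,
    [/\ Lip1 n g, forall x, `|g x - f x| <= k%:R * e, 0 <= L &
      forall i, (i < k)%N -> lip1 L (p i) /\ partial_with L i g (p i)].
  move=> /(_ n (leqnn n))[g [p [L [gL gf L0 gp]]]].
  by exists g, p, L; split=> // i; exact: gp.
elim=> [_|k IH kn].
  exists f, (fun _ _ => 0), 0; split=> // x.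
  by rewrite subrr normr0 mul0r.
have [g [p [L [gL gf L0 gp]]]] := IH (ltnW kn).
pose i0 := Ordinal kn.
exists (smooth e i0 g), (fun i => if i == i0 then diff_quotient e i0 g else smooth e i0 (p i)).
exists (L + 2 * 1 / e); have e20 : 0 <= 2 * 1 / e by rewrite divr_ge0// ltW.
split; first exact: smooth_Lip1.
- move=> x; rewrite -(subrK (g x) (smooth _ _ _ _)) -addrA.
  rewrite (le_trans (ler_normD _ _))// -natr1 mulrDl mul1r [leRHS]addrC lerD//.
  exact: smooth_dist (Lip1_lip1 gL).
- exact: addr_ge0.
move=> i; rewrite ltnS leq_eqVlt; have [-> _|ii0 /=] := eqVneq i i0.
  have h : 2 * 1 / e <= L + 2 * 1 / e by rewrite lerDr.
  split; first exact/(lip1W h)/diff_quotient_lip1/Lip1_lip1.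
  exact/(partial_withW h)/smooth_partial_self/Lip1_lip1.
have h : L <= L + 2 * 1 / e by rewrite lerDl.
case/predU1P => [ik|/gp[pL gpL]]; first by case/eqP: ii0; exact: val_inj.
split; first exact/(lip1W h)/smooth_lip1.
by apply/(partial_withW h)/smooth_partial => //; exact: (Lip1_lip1 gL).
Qed.

End smoothing.

(** * The gradient bound for smoothed Lipschitz functions *)

Section gradient.
Context {R : realType} {n : nat}.
Implicit Types (x y : n.-tuple R) (g : n.-tuple R -> R).

Let partial_step (a : 'I_n -> R) x k : n.-tuple R :=
  [tuple tnth x j + (if (j < k)%N then a j else 0) | j < n].

(** The increment is telescoped along a path changing one coordinate at a time. Each of the n steps
    loses at most L A^2, where A is the sum of the |a i|, in its Taylor error, and L A^2 again for
    evaluating [p i] at x instead of at the current point. *)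
Lemma increment_ge (L : R) g (p : 'I_n -> n.-tuple R -> R) x (a : 'I_n -> R) :
  0 <= L -> (forall i, lip1 L (p i)) -> (forall i, partial_with L i g (p i)) ->
  \sum_i a i * p i x - n%:R * (2 * L * (\sum_i `|a i|) ^+ 2)
  <= g [tuple tnth x j + a j | j < n] - g x.
Proof.
move=> L0 pL gp; set A := \sum_i `|a i|.
have aA i : `|a i| <= A by rewrite /A (bigD1 i)//= lerDl sumr_ge0.
have A0 : 0 <= A by exact: sumr_ge0.
suff : forall k, (k <= n)%N ->
    \sum_(i < n | (i < k)%N) a i * p i x - k%:R * (2 * L * A ^+ 2)
    <= g (partial_step a x k) - g x.
  move=> /(_ n (leqnn n)); congr (_ - _ <= g _ - _).
    by apply: eq_bigl => i; rewrite ltn_ord.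
  by apply: eq_from_tnth => i; rewrite !tnth_mktuple ltn_ord.
elim=> [_|k IH kn].
  rewrite big_pred0// mul0r (_ : partial_step a x 0 = x) ?subrr//.
  by apply: eq_from_tnth => i; rewrite !tnth_mktuple addr0.
have {}IH := IH (ltnW kn).
pose i := Ordinal kn; pose y := partial_step a x k.
have yS : partial_step a x k.+1 = tshift i (a i) y.
  apply: eq_from_tnth => j; rewrite !tnth_mktuple ltnS leq_eqVlt -addrA.
  have [->|ji] := eqVneq j i; first by rewrite eqxx/= ltnn add0r.
  rewrite addr0; case: eqP => // jk; first by case/eqP: ji; exact: val_inj.
have xy : dist1 y x <= A.
  apply: ler_sum => j _; rewrite tnth_mktuple addrAC subrr add0r.
  by case: ifP => // _; rewrite normr0.
have := pL i y x; have := gp i y (a i).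
rewrite -yS (bigD1 i)//= (eq_bigl (fun j : 'I_n => (j < k)%N)); last first.
  move=> j; rewrite ltnS leq_eqVlt; have [->|ji] := eqVneq j i.
    by rewrite andbF ltnn.
  by rewrite andbT; case: eqP => // jk; case/eqP: ji; exact: val_inj.
rewrite -[k.+1%:R]natr1 -/y in IH *; set S := \sum_(j < n | _) _ in IH *.
move=> /ler_normlP[h1 _] h2.
have h3 : a i * (p i x - p i y) <= L * A ^+ 2.
  rewrite (le_trans (ler_norm _))// normrM mulrC expr2 mulrA ler_pM//.
  by rewrite distrC (le_trans h2)// ler_wpM2l.
have h4 : L * a i ^+ 2 <= L * A ^+ 2.
  by rewrite ler_wpM2l// -real_normK ?num_real// lerXn2r ?nnegrE.
rewrite mulrBr in h3; rewrite mulrDl mul1r.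
lra.
Qed.

(* Move from x by h * p(x) and let h tend to 0. *)
Lemma Lip1_gradient_le1 (L : R) g (p : 'I_n -> n.-tuple R -> R) x :
  0 <= L -> (forall i, lip1 L (p i)) -> (forall i, partial_with L i g (p i)) ->
  Lip1 n g -> \sum_i p i x ^+ 2 <= 1.
Proof.
move=> L0 pL gp gL; set S := \sum_i _; pose B := \sum_i `|p i x|.
have S0 : 0 <= S by apply: sumr_ge0 => i _; exact: sqr_ge0.
pose C := n%:R * (2 * L * B ^+ 2).
have C0 : 0 <= C by rewrite mulr_ge0// mulr_ge0 ?sqr_ge0// mulr_ge0.
(* The increment of [g] along h * p(x) is at least h S - h^2 C and at most h sqrt S, the length of
   the displacement; divide by h. *)
have key h : 0 < h -> S <= Num.sqrt S + h * C.
  move=> h0; have := increment_ge x (fun i => h * p i x) L0 pL gp.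
  have := gL [tuple tnth x j + h * p j x | j < n] x.
  rewrite (_ : euclidean_dist _ _ = h * Num.sqrt S); last first.
    rewrite -[X in X * _](gtr0_norm h0) -sqrtr_sqr -sqrtrM ?sqr_ge0//.
    rewrite mulr_sumr; congr Num.sqrt; apply: eq_bigr => i _.
    by rewrite tnth_mktuple addrAC subrr add0r exprMn.
  move=> /ler_normlP[_ h1].
  rewrite (_ : \sum_i h * p i x * p i x = h * S); last first.
    by rewrite mulr_sumr; apply: eq_bigr => i _; rewrite expr2 mulrA.
  rewrite (_ : \sum_i `|h * p i x| = h * B); last first.
    by rewrite mulr_sumr; apply: eq_bigr => i _; rewrite normrM gtr0_norm.
  move=> /le_trans/(_ h1); rewrite lerBlDr => h2.
  rewrite -(ler_pM2l h0) mulrDr; apply: le_trans h2 _.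
  by rewrite lerD2l /C exprMn expr2 le_eqVlt; apply/predU1P; left; ring.
have {key}SS : S <= Num.sqrt S.
  apply/ler_addgt0Pr => e e0.
  have C1 : 0 < C + 1 by rewrite ltr_wpDl.
  have := key (e / (C + 1)); rewrite divr_gt0// => /(_ isT) /le_trans; apply.
  by rewrite lerD2l mulrAC ler_pdivrMr// ler_pM2l// lerDl.
rewrite -(@sqr_sqrtr _ S)//; have := sqrtr_ge0 S.
rewrite -{1}(@sqr_sqrtr _ S)// in SS; move: (Num.sqrt S) SS => t; nra.
Qed.

End gradient.

(** * Product measures *)

(* The sublevel sets of f are countable unions of those of the functions
   x |-> f q + K * dist1 x q, for q in a countable dense set. *)
Lemma lip1_measurable {R : realType} n L (f : n.-tuple (measurableTypeR R) -> R) :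
  lip1 L f -> measurable_fun [set: n.-tuple (measurableTypeR R)] f.
Proof.
move=> fL0; pose K := `|L| + 1; have K0 : 0 < K by rewrite ltr_wpDl.
have fK : lip1 K f.
  by apply: lip1W fL0; rewrite (le_trans (ler_norm _))// lerDl.
pose rt (q : n.-tuple rat) : n.-tuple (measurableTypeR R) :=
  [tuple ratr (tnth q i) | i < n].
apply: (measurability (@RGenInftyO.G R)).
  exact: RGenInftyO.measurableE.
move=> _ [_ [c ->] <-]; rewrite setTI.
rewrite (_ : _ @^-1` _ = \bigcup_q [set x | f (rt q) + K * dist1 x (rt q) < c]).
  apply: countable_bigcupT_measurable; first exact: countableP.
  move=> q; rewrite -[X in measurable X]setTI.
  rewrite (_ : [set x | _] =
      (fun x => f (rt q) + K * dist1 x (rt q)) @^-1` `]-oo, c[%classic); last first.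
    by apply/seteqP; split => x /=; rewrite in_itv.
  suff : measurable_fun [set: n.-tuple (measurableTypeR R)]
      (fun x => f (rt q) + K * dist1 x (rt q)) by exact.
  apply: measurable_funD => //; apply: measurable_funM => //.
  apply: measurable_sum => i; apply: measurableT_comp => //.
  by apply: measurable_funB => //; exact: measurable_tnth.
apply/seteqP; split=> [x|x [q _]] /=; rewrite in_itv/=; last first.
  apply: le_lt_trans; rewrite -lerBlDl; apply: le_trans (fK _ _).
  exact: ler_norm.
(* A rational y with coordinates within d of those of x satisfies f y + K dist1 x y <= f x + 2 K n d
   < c; the factor n + 1 makes the last inequality strict and covers n = 0. *)
move=> fc; pose d := (c - f x) / (K * 2 * n.+1%:R).
have d0 : 0 < d by rewrite divr_gt0 ?subr_gt0// !mulr_gt0.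
have /fin_all_exists[q qx] : forall i : 'I_n, exists q : rat, `|tnth x i - ratr q| < d.
  move=> i; have [|q] := @rat_in_itvoo R (tnth x i - d) (tnth x i + d).
    by rewrite ltrD2l gtrN.
  by rewrite in_itv/= => /andP[? ?]; exists q; rewrite ltr_distlC; apply/andP.
exists [tuple q i | i < n] => //=; set y := rt _.
have xy : dist1 x y <= n%:R * d.
  rewrite (le_trans (ler_sum _ (G := fun=> d) _))//; last first.
    by rewrite sumr_const card_ord mulr_natl.
  by move=> i _; rewrite !tnth_mktuple ltW.
have h1 : f y - f x <= K * dist1 x y.
  by apply: le_trans (fK _ _); rewrite distrC ler_norm.
have h2 : K * dist1 x y <= K * (n%:R * d) by rewrite ler_pM2l.
have h3 : K * (n%:R * d) * 2 < c - f x.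
  rewrite /d [ltLHS](_ : _ = (c - f x) * (n%:R / n.+1%:R)).
    by rewrite gtr_pMr ?subr_gt0// ltr_pdivrMr// mul1r ltr_nat.
  by field; rewrite [1 + _]addrC natr1 pnatr_eq0/= gt_eqF//.
by lra.
Qed.

Section power_integral.
Context d (T : measurableType d) (R : realType) (P : probability T R) (n : nat).
Implicit Types (g : n.+1.-tuple T -> \bar R).
Local Open Scope ereal_scope.

Lemma measurable_cons_pair :
  measurable_fun [set: T * n.-tuple T] (fun z : T * n.-tuple T => [tuple of z.1 :: z.2]).
Proof. exact: measurable_cons. Qed.

Lemma measurable_power_section g : measurable_fun [set: n.+1.-tuple T] g ->
  (forall x, 0 <= g x) ->
  measurable_fun [set: T]
    (fun x => \int[power_probability P n]_y g [tuple of x :: y]).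
Proof.
move=> mg g0; apply: (@measurable_fun_fubini_tonelli_F _ _ _ _ _ (power_probability P n)
  (fun z => g [tuple of z.1 :: z.2])) => //.
by apply: (measurableT_comp mg); exact: measurable_cons_pair.
Qed.

Lemma ge0_integral_power g : measurable_fun [set: n.+1.-tuple T] g ->
  (forall x, 0 <= g x) ->
  \int[power_probability P n.+1]_x g x =
  \int[P]_x \int[power_probability P n]_y g [tuple of x :: y].
Proof.
move=> mg g0; rewrite /= ge0_integral_distribution//.
rewrite /product_probability fubini_tonelli1//; last by move=> x; exact: g0.
by apply: (measurableT_comp mg); exact: measurable_cons_pair.
Qed.

End power_integral.

(** * Integrals against the Pareto distribution *)

Section density.
Context d (T : measurableType d) (R : realType).
Variables (mu nu : {measure set T -> \bar R}) (w : T -> R).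
Hypotheses (mw : measurable_fun [set: T] w) (w0 : forall x, 0 <= w x).
Hypothesis nuE : forall A, measurable A -> nu A = (\int[mu]_(x in A) (w x)%:E)%E.
Let mwE : measurable_fun [set: T] (EFin \o w). Proof. exact/measurable_EFinP. Qed.
Local Open Scope ereal_scope.

Import HBNNSimple.

Let density_nnsfun (f : {nnsfun T >-> R}) :
  \int[nu]_x (f x)%:E = \int[mu]_x ((f x)%:E * (w x)%:E).
Proof.
under [LHS]eq_integral do rewrite fimfunE -fsumEFin//.
rewrite [LHS]ge0_integral_fsum//; last 2 first.
  - by move=> r; exact/measurable_EFinP/measurableT_comp.
  - by move=> n x _; rewrite EFinM nnfun_muleindic_ge0.
under [RHS]eq_integral.
  move=> x xD; rewrite fimfunE -fsumEFin// ge0_mule_fsuml; last first.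
    by move=> r; rewrite EFinM nnfun_muleindic_ge0.
  over.
rewrite [RHS]ge0_integral_fsum//; last 2 first.
  - by move=> r; apply: emeasurable_funM => //; exact/measurable_EFinP/measurableT_comp.
  - by move=> n x _; rewrite mule_ge0 ?[_ <= (w _)%:E]lee_fin// EFinM nnfun_muleindic_ge0.
apply: eq_fsbigr => r _.
rewrite integralZl_indic_nnsfun// integral_indic// setIT nuE//.
under [RHS]eq_integral do rewrite EFinM -muleA.
have [r0|r0] := leP 0%R r.
  rewrite ge0_integralZl//; last 2 first.
  - by apply: emeasurable_funM => //; exact/measurable_EFinP.
  - by move=> x _; rewrite mule_ge0// lee_fin.
  congr (_ * _); rewrite integral_mkcond; apply: eq_integral => x _.
  by rewrite patchE indicE; case: ifP; rewrite ?mul1e ?mul0e.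
rewrite preimage_nnfun0// integral_set0 mule0 integral0_eq// => x _.
by rewrite indicE in_set0 mul0e mule0.
Qed.

Lemma ge0_integral_density (f : T -> \bar R) :
  measurable_fun [set: T] f -> (forall x, 0 <= f x) ->
  \int[nu]_x f x = \int[mu]_x (f x * (w x)%:E).
Proof.
move=> mf f0; pose f_ := nnsfun_approx measurableT mf.
transitivity (lim (\int[nu]_x (f_ n x)%:E @[n --> \oo])).
  rewrite -monotone_convergence//=.
  - apply: eq_integral => ? /[!inE] xD; apply/esym/cvg_lim => //=.
    exact: cvg_nnsfun_approx.
  - by move=> n; exact/measurable_EFinP/measurable_funTS.
  - by move=> n ? _; rewrite lee_fin.
  - by move=> ? _ ? ? mn; rewrite lee_fin; exact/lefP/nd_nnsfun_approx.
under eq_fun do rewrite density_nnsfun.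
rewrite -monotone_convergence//=.
- apply: eq_integral => x _; apply/cvg_lim => //; apply: cvgeZr => //.
  exact: cvg_nnsfun_approx.
- by move=> n; apply: emeasurable_funM => //; exact/measurable_EFinP/measurable_funTS.
- by move=> n x _; rewrite mule_ge0// lee_fin.
- move=> x _ m n mn; rewrite lee_wpmul2r ?lee_fin//; exact/lefP/nd_nnsfun_approx.
Qed.

End density.

Lemma continuous_powR_gt0 {R : realType} (a x : R) : 0 < x ->
  {for x, continuous (@powR R ^~ a)}.
Proof.
move=> x0; apply/differentiable_continuous/derivable1_diffP.
exact: (@ex_derive _ _ _ _ _ _ _ (is_derive1_powR a x0)).
Qed.

Section pareto_integral.
Context {R : realType}.
Notation mu := (@lebesgue_measure R).
Local Open Scope ereal_scope.

(** The integrand is the derivative of -x^b, which tends to 0 at infinity. It is applied with b = 1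
    - lambda for tail probabilities and b = 3 - lambda for tail second moments. *)
Lemma integral_powR_tail (b t : R) : (b < 0)%R -> (0 < t)%R ->
  \int[mu]_(x in `[t, +oo[) (- b * x `^ (b - 1))%:E = (t `^ b)%:E.
Proof.
move=> b0 t0.
have dF (x : R) : (0 < x)%R ->
    is_derive x 1%R (fun x => (- x `^ b)%R) (- b * x `^ (b - 1))%R.
  by move=> x0; rewrite mulNr; apply: is_deriveN; exact: is_derive1_powR.
rewrite (@ge0_continuous_FTC2y _ _ (fun x => (- x `^ b)%R) t 0%R)//.
- by rewrite EFinN oppeK add0e.
- by move=> x _; rewrite mulr_ge0 ?powR_ge0// oppr_ge0 ltW.
- apply: continuous_in_subspaceT => x; rewrite inE/= in_itv/= andbT => x1.
  apply: (@continuousM _ R^o (fun=> - b)%R (fun y => y `^ (b - 1))%R).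
    exact: cst_continuous.
  by apply: continuous_powR_gt0; exact: lt_le_trans x1.
- rewrite -oppr0; apply: cvgN.
  apply/cvgr0Pnorm_lt => e e0; near=> x.
  have x0 : (0 < x)%R by [].
  have l1 : (0 < - b)%R by rewrite oppr_gt0.
  rewrite ger0_norm ?powR_ge0// -[b]opprK powRN invf_plt ?posrE ?powR_gt0//.
  have -> : (e^-1 = (e^-1 `^ (- b)^-1) `^ (- b))%R.
    by rewrite -powRrM mulVf ?gt_eqF// powRr1// invr_ge0 ltW.
  apply: gt0_ltr_powR; rewrite ?nnegrE ?powR_ge0 ?(ltW x0)//.
- by move=> x x1; apply: ex_derive; apply: dF; exact: lt_trans x1.
- by apply: cvg_at_right_filter; apply: cvgN; exact: continuous_powR_gt0.
- move=> x; rewrite in_itv/= andbT => x1.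
  by rewrite derive1E; apply: derive_val; apply: dF; exact: lt_trans x1.
Unshelve. all: by end_near. Qed.

Context (lambda : R) (l1 : (1 < lambda)%R).
Notation P := (pareto_probability l1).

Lemma ge0_integral_pareto (g : R -> \bar R) :
  measurable_fun [set: measurableTypeR R] g -> (forall x, 0 <= g x) ->
  \int[P]_x g x =
  \int[mu]_(x in `[1%R, +oo[) (g x * ((lambda - 1) * x `^ (- lambda))%:E).
Proof.
move=> mg g0.
rewrite (@ge0_integral_density _ _ _ mu P (pareto_pdf lambda))//; last 2 first.
- exact: measurable_pareto_pdf.
- exact: pareto_pdf_ge0.
rewrite [RHS]integral_mkcond; apply: eq_integral => x _.
by rewrite /pareto_pdf !patchE; case: ifP => //; rewrite mule0.
Qed.

(** x^2 times the density is (lambda - 1) / (lambda - 3) times the derivative of -x^(3 - lambda),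
    and lambda > 3 makes this power decay. *)
Lemma pareto_second_moment_tail (t : R) : (3 < lambda)%R -> (1 <= t)%R ->
  \int[P]_x (x ^+ 2 * \1_(`[t, +oo[%classic) x)%:E =
  ((lambda - 1) / (lambda - 3) * t `^ (3 - lambda))%:E.
Proof.
move=> l3 t1; rewrite ge0_integral_pareto; last 2 first.
- apply/measurable_EFinP; apply: measurable_funM => //.
- by move=> x; rewrite lee_fin mulr_ge0// sqr_ge0.
have l3' : (0 < lambda - 3)%R by rewrite subr_gt0.
transitivity (\int[mu]_(x in `[t, +oo[)
  (((lambda - 1) / (lambda - 3))%:E * (- (3 - lambda) * x `^ (3 - lambda - 1))%:E)).
  rewrite integral_mkcond [RHS]integral_mkcond; apply: eq_integral => x _.
  rewrite !patchE !indicE !mem_setE !in_itv/= !andbT.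
  have [tx|_] := leP t x; last by rewrite mulr0 mul0e if_same.
  have x1 := le_trans t1 tx; rewrite x1 mulr1 -!EFinM; congr EFin.
  have -> : (3 - lambda - 1 = 2%:R - lambda)%R by ring.
  have x0 : (0 < x)%R by exact: lt_le_trans x1.
  rewrite powRB ?(gt_eqF x0) ?implybT// powR_mulrn ?(ltW x0)// powRN.
  by field; rewrite !gt_eqF ?powR_gt0.
rewrite ge0_integralZl//; last 3 first.
- apply/measurable_EFinP/measurable_funTS; apply: measurable_funM => //.
- by move=> x _; rewrite lee_fin mulr_ge0 ?powR_ge0// opprB ltW.
- by rewrite lee_fin divr_ge0// ltW// subr_gt0.
rewrite integral_powR_tail ?EFinM//; first by rewrite subr_lt0.
exact: lt_le_trans t1.
Qed.

Lemma pareto_tail (t : R) : (1 <= t)%R -> P `[t, +oo[%classic = (t `^ (1 - lambda))%:E.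
Proof.
move=> t1; rewrite -(@integral_powR_tail (1 - lambda) t); last 2 first.
- by rewrite subr_lt0.
- exact: lt_le_trans t1.
rewrite /pareto_probability /= /pareto_prob.
rewrite integral_mkcond [RHS]integral_mkcond; apply: eq_integral => x _.
rewrite /pareto_pdf !patchE !mem_setE !in_itv/= !andbT.
case: ifPn => // tx; rewrite (le_trans t1 tx).
by rewrite opprB addrAC subrr add0r.
Qed.

End pareto_integral.

(** * The Poincare inequality *)

Section weighted_poincare.
Context {R : realType}.
Notation mu := (@lebesgue_measure R).

Lemma taylor_is_derive (L : R) (g q : R -> R) x :
  (forall a, `|g (x + a) - g x - a * q x| <= L * a ^+ 2) ->
  is_derive x 1 g (q x).
Proof.
move=> gq; have h : h^-1 *: (g (h *: 1 + x) - g x) @[h --> 0^'] --> q x.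
  apply/cvgrPdist_le => /= e e0; pose K := `|L| + 1.
  have K0 : 0 < K by rewrite ltr_wpDl.
  near=> h; have h0 : h != 0 by near: h; exact: nbhs_dnbhs_neq.
  have hn : `|h| <= e / K.
    near: h; apply: dnbhs0_le; exact: divr_gt0.
  rewrite /GRing.scale/= mulr1 distrC [h + x]addrC.
  rewrite (_ : _ - q x = h^-1 * (g (x + h) - g x - h * q x)); last by field.
  rewrite normrM normfV ler_pdivrMl ?normr_gt0// (le_trans (gq h))//.
  rewrite -real_normK ?num_real// mulrC expr2 -mulrA ler_wpM2l//.
  apply: (@le_trans _ _ (`|h| * K)); last by rewrite -ler_pdivlMr.
  by rewrite ler_wpM2l// (le_trans (ler_norm _))// lerDl.
apply: DeriveDef; first by apply/cvg_ex; exists (q x).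
exact/cvg_lim.
Unshelve. all: by end_near. Qed.

Context (lambda : R) (l1 : 1 < lambda).
Notation P := (pareto_probability l1).

(** A Hardy inequality, with a pointwise completed square in place of Cauchy-Schwarz, so that no
    possibly infinite integral has to be divided out. It is integrated over [1, N] and N tends to
    infinity by monotone convergence, which requires no decay of [g]. *)
Lemma weighted_poincare (L : R) (g q : R -> R) : continuous q ->
  (forall x a, `|g (x + a) - g x - a * q x| <= L * a ^+ 2) ->
  (\int[P]_x ((g x - g 1) ^+ 2)%:E <=
   (4 / (lambda - 1) ^+ 2)%:E * \int[P]_x (x ^+ 2 * q x ^+ 2)%:E)%E.
Proof.
move=> cq gq; have dg (x : R) : is_derive x 1 g (q x) by exact: taylor_is_derive (gq x).
have cg : continuous g.
  move=> x; apply/differentiable_continuous/derivable1_diffP.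
  exact: (@ex_derive _ _ _ _ _ _ _ (dg x)).
pose u x := g x - g 1.
have du (x : R) : is_derive x 1 u (q x).
  by rewrite -[q x]subr0; apply: is_deriveB.
have cu : continuous u by move=> x; apply: cvgB; [exact: cg|exact: cvg_cst].
pose al := lambda - 1; have al0 : 0 < al by rewrite subr_gt0.
pose G x := - (u x * u x * x `^ (1 - lambda)).
(* dG = G', and 2 dG + K B - A is a square times x^(- lambda) (see AB). *)
pose dG x := al * (u x * u x) * x `^ (- lambda) - 2 * (u x * q x) * x `^ (1 - lambda).
pose A x := u x ^+ 2 * (al * x `^ (- lambda)).
pose B x := x ^+ 2 * q x ^+ 2 * (al * x `^ (- lambda)).
pose K : R := 4 / al ^+ 2.
have K0 : 0 <= K by rewrite divr_ge0// sqr_ge0.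
have A0 x : 0 <= A x by rewrite mulr_ge0 ?sqr_ge0// mulr_ge0 ?powR_ge0// ltW.
have B0 x : 0 <= B x by apply: mulr_ge0; apply: mulr_ge0; rewrite ?sqr_ge0 ?powR_ge0// ltW.
have AB x : 1 <= x -> A x <= 2 * dG x + K * B x.
  move=> x1; have x0 : 0 < x by exact: lt_le_trans x1.
  rewrite /A /B /dG [x `^ (1 - lambda)]powRD ?(gt_eqF x0) ?implybT// powRr1 ?(ltW x0)//.
  rewrite -subr_ge0 (_ : _ - _ = x `^ (- lambda) * al^-1 * (al * u x - 2 * x * q x) ^+ 2).
    by rewrite mulr_ge0 ?sqr_ge0// mulr_ge0 ?powR_ge0// invr_ge0 ltW.
  by rewrite /K; field; rewrite gt_eqF.
have dGP (x : R) : 0 < x -> is_derive x 1 G (dG x).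
  move=> x0; have := is_deriveN (is_deriveM (is_deriveM (du x) (du x))
    (is_derive1_powR (1 - lambda) x0)).
  move=> h; apply: (is_derive_eq h); rewrite /dG /al /GRing.scale/=.
  have -> : 1 - lambda - 1 = - lambda by ring.
  by rewrite -[(u * u) x]/(u x * u x); ring.
have cA (x : R) : 0 < x -> {for x, continuous A}.
  move=> x0; apply: cvgM; first by apply: cvgM; exact: cu.
  by apply: cvgM; [exact: cvg_cst|exact: continuous_powR_gt0].
have cB (x : R) : 0 < x -> {for x, continuous B}.
  move=> x0; apply: cvgM; last by apply: cvgM; [exact: cvg_cst|exact: continuous_powR_gt0].
  by apply: cvgM; apply: cvgM; (exact: cvg_id || exact: cq).
have cdG (x : R) : 0 < x -> {for x, continuous dG}.
  move=> x0; apply: cvgB; apply: cvgM; (try exact: continuous_powR_gt0);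
    apply: cvgM; try exact: cvg_cst.
    by apply: cvgM; exact: cu.
  by apply: cvgM; [exact: cu|exact: cq].
have iseg (f : R -> R) N : (forall x, 0 < x -> {for x, continuous f}) ->
    mu.-integrable `[1, N] (EFin \o f).
  move=> cf; apply: continuous_compact_integrable; first exact: segment_compact.
  apply: continuous_in_subspaceT => x; rewrite inE/= in_itv/= => /andP[x1 _].
  by apply: cf; exact: lt_le_trans x1.
have measurable_u : measurable_fun [set: R] u by exact: continuous_measurable_fun.
have measurable_q : measurable_fun [set: R] q by exact: continuous_measurable_fun.
have mw : measurable_fun [set: R] (fun x => al * x `^ (- lambda)).
  by apply: measurable_funM => //; exact: measurable_powR.
have mx2q2 : measurable_fun [set: R] (fun x => x ^+ 2 * q x ^+ 2).
  by apply: measurable_funM => //; exact: measurable_funX.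
have mA : measurable_fun [set: R] A.
  by apply: measurable_funM => //; exact: measurable_funX.
have mB : measurable_fun [set: R] B by exact: measurable_funM.
have key (n : nat) : (\int[mu]_(x in `[1%R, n.+2%:R]) (A x)%:E <=
    K%:E * \int[mu]_(x in `[1%R, +oo[) (B x)%:E)%E.
  (* The shift by 2 keeps [1, N] nondegenerate for every n. *)
  set N := n.+2%:R; have N1 : 1 < N by rewrite ltr1n.
  have iA := iseg A N cA; have iB := iseg B N cB; have idG := iseg dG N cdG.
  have i2dG : mu.-integrable `[1, N] (fun x => 2%:E * (dG x)%:E)%E.
    exact: integrableZl.
  have iKB : mu.-integrable `[1, N] (fun x => K%:E * (B x)%:E)%E.
    exact: integrableZl.
  apply: (@le_trans _ _ (\int[mu]_(x in `[1%R, N]) (2%:E * (dG x)%:E + K%:E * (B x)%:E))%E).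
    apply: ge0_le_integral => //.
    - by move=> x _; rewrite lee_fin.
    - exact: (measurable_int mu).
    - by apply: (measurable_int mu); exact: integrableD.
    - move=> x /=; rewrite in_itv/= => /andP[x1 _].
      by rewrite -!EFinM -EFinD lee_fin AB.
  rewrite integralD// !integralZl//.
  rewrite (@continuous_FTC2 _ dG G 1 N)//; last 3 first.
  - apply: continuous_in_subspaceT => x; rewrite inE/= in_itv/= => /andP[x1 _].
    by apply: cdG; exact: lt_le_trans x1.
  - have cG (x : R) : 0 < x -> {for x, continuous G}.
      move=> x0; apply/differentiable_continuous/derivable1_diffP.
      exact: (@ex_derive _ _ _ _ _ _ _ (dGP x x0)).
    split.
    + move=> x; rewrite in_itv/= => /andP[x1 _].
      by apply: (@ex_derive _ _ _ _ _ _ _ (dGP x _)); exact: lt_trans x1.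
    + by apply: cvg_at_right_filter; exact: cG.
    + by apply: cvg_at_left_filter; apply: cG; exact: lt_trans N1.
  - move=> x; rewrite in_itv/= => /andP[x1 _]; rewrite derive1E.
    by apply: derive_val; apply: dGP; exact: lt_trans x1.
  (* The boundary term 2 (G N - G 1) is nonpositive: u 1 = 0 gives G 1 = 0, and G is minus a square
     times a power. *)
  rewrite -[leRHS]add0e; apply: leeD.
    rewrite -EFinB -EFinM lee_fin /G /u subrr !mul0r oppr0 subr0 mulrN oppr_le0.
    by rewrite mulr_ge0// mulr_ge0 ?powR_ge0// -expr2 sqr_ge0.
  rewrite lee_wpmul2l ?lee_fin//; apply: ge0_subset_integral => //.
  - by apply/measurable_EFinP/measurable_funTS; exact: mB.
  - by move=> x _; rewrite lee_fin.
  - by move=> x /=; rewrite !in_itv/= andbT => /andP[].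
rewrite !ge0_integral_pareto//; last 4 first.
- exact/measurable_EFinP.
- by move=> x; rewrite lee_fin mulr_ge0 ?sqr_ge0.
- by apply/measurable_EFinP; apply: measurable_funX.
- by move=> x; rewrite lee_fin sqr_ge0.
have itvE : `[1%R, +oo[%classic = \bigcup_n `[1%R, n.+2%:R : R]%classic.
  apply/seteqP; split => x; rewrite /= in_itv/= ?andbT.
    move=> x1; exists (Num.trunc x) => //=; rewrite in_itv/= x1/=.
    by rewrite (le_trans (ltW (truncnS_gt x)))// ler_nat.
  by move=> [n _] /=; rewrite in_itv/= => /andP[].
rewrite [X in (\int[mu]_(x in X) _ <= _)%E]itvE.
apply: (cvge_to_le (ge0_nondecreasing_set_cvg_integral _ _ _ _)).
- move=> m n mn; rewrite subsetEset => x /=; rewrite !in_itv/= => /andP[-> /=].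
  by move=> /le_trans; apply; rewrite ler_nat.
- by [].
- by move=> n; apply/measurable_EFinP/measurable_funTS; exact: mA.
- by move=> n x _; rewrite lee_fin A0.
- near=> n.
  exact: key.
Unshelve. all: by end_near. Qed.

End weighted_poincare.

Lemma integral_probability_cst {d} {T : measurableType d} {R : realType}
    (P : probability T R) (c : \bar R) : (\int[P]_x c = c)%E.
Proof. by rewrite integral_cst//= probability_setT mule1. Qed.

(** * Second moments about a point, and square integrability *)

Section bias_variance.
Context d (T : measurableType d) (R : realType) (P : probability T R).

Lemma sqr_integrable_integrable (X : T -> R) : measurable_fun [set: T] X ->
  (\int[P]_x (X x ^+ 2)%:E < +oo)%E -> P.-integrable [set: T] (EFin \o X).
Proof.
move=> mX X2; have iX2 : P.-integrable [set: T] (fun x => (X x ^+ 2)%:E).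
  apply/integrableP; split; first by apply/measurable_EFinP/measurable_funX.
  by under eq_integral do rewrite abse_EFin (ger0_norm (sqr_ge0 _)).
apply: (@le_integrable _ _ _ _ _ measurableT _ (fun x => (X x ^+ 2)%:E + 1%:E)%E).
- exact/measurable_EFinP.
- move=> x _; rewrite -EFinD !abse_EFin lee_fin.
  rewrite [leRHS]ger0_norm ?addr_ge0 ?sqr_ge0//.
  by rewrite -real_normK ?num_real//; move: `|X x| => t; nra.
- by apply: integrableD => //; exact: finite_measure_integrable_cst.
Qed.

(** It serves three purposes: the variance is at most the second moment about any c; a second moment
    about c splits into a variance and a squared bias; and c = 0 gives Jensen's inequality for the
    square. *)
Lemma bias_variance (X : T -> R) c : measurable_fun [set: T] X ->
  (\int[P]_x (X x ^+ 2)%:E < +oo)%E -> let m := fine (\int[P]_x (X x)%:E) in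
  (\int[P]_x ((X x - c) ^+ 2)%:E =
   \int[P]_x ((X x - m) ^+ 2)%:E + ((m - c) ^+ 2)%:E)%E.
Proof.
move=> mX X2 m; have iX := sqr_integrable_integrable mX X2.
have iX2 : P.-integrable [set: T] (fun x => (X x ^+ 2)%:E).
  apply/integrableP; split; first by apply/measurable_EFinP/measurable_funX.
  by under eq_integral do rewrite abse_EFin (ger0_norm (sqr_ge0 _)).
have ic r : P.-integrable [set: T] (fun=> r%:E).
  exact: finite_measure_integrable_cst.
have EX : (\int[P]_x (X x)%:E = m%:E)%E.
  by rewrite fineK// integrable_fin_num.
have E r : (\int[P]_x ((X x - r) ^+ 2)%:E =
    \int[P]_x (X x ^+ 2)%:E - (2 * r * m)%:E + (r ^+ 2)%:E)%E.
  transitivity (\int[P]_x ((X x ^+ 2)%:E - (2 * r)%:E * (X x)%:E + (r ^+ 2)%:E))%E.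
    apply: eq_integral => x _; rewrite -EFinM -EFinB -EFinD; congr EFin; ring.
  rewrite integralD//; last by apply: integrableB => //; exact: integrableZl.
  rewrite integralB//; last exact: integrableZl.
  by rewrite integralZl// EX -EFinM integral_probability_cst.
rewrite !E -(fineK (integrable_fin_num measurableT iX2)) -!EFinB -!EFinD.
by congr EFin; ring.
Qed.

End bias_variance.

Section coordinate_sums.
Context d (T : measurableType d) (R : realType) (P : probability T R).
Local Open Scope ereal_scope.

Lemma integral_sum_tnth n (h : T -> \bar R) : measurable_fun [set: T] h ->
  (forall x, 0 <= h x) ->
  \int[power_probability P n]_x (\sum_(i < n) h (tnth x i)) =
  n%:R%:E * \int[P]_x h x.
Proof.
move=> mh h0; have ms k : measurable_fun [set: k.-tuple T]
    (fun x => \sum_(i < k) h (tnth x i)).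
  by apply: emeasurable_sum => i; apply: measurableT_comp => //; exact: measurable_tnth.
have s0 k (x : k.-tuple T) : 0 <= \sum_(i < k) h (tnth x i).
  by apply: sume_ge0.
elim: n => [|n IH].
  by under eq_integral do rewrite big_ord0; rewrite integral0 mul0e.
rewrite ge0_integral_power//.
transitivity (\int[P]_x (h x + n%:R%:E * \int[P]_x h x)).
  apply: eq_integral => x _; rewrite -IH.
  under eq_integral.
    move=> y _; rewrite big_ord_recl tnth0.
    under eq_bigr do rewrite tnthS.
    over.
  rewrite ge0_integralD//; last exact: ms.
  by rewrite integral_probability_cst.
rewrite ge0_integralD//.
- rewrite integral_probability_cst.
  by rewrite -natr1 EFinD ge0_muleDl ?lee_fin// mul1e addeC.
- by move=> x _; rewrite mule_ge0 ?lee_fin//; exact: integral_ge0.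
Qed.

End coordinate_sums.

Lemma sqr_sum_le {R : realType} n (a : 'I_n -> R) :
  (\sum_i a i) ^+ 2 <= n%:R * \sum_i a i ^+ 2.
Proof.
have -> : n%:R * \sum_i a i ^+ 2 = \sum_i \sum_j (a i ^+ 2 + a j ^+ 2) / 2.
  under [RHS]eq_bigr do rewrite -mulr_suml big_split/= sumr_const card_ord.
  rewrite -mulr_suml big_split/= sumr_const card_ord sumrMnl -[_ *+ n]mulr_natl.
  by field.
rewrite expr2 mulr_suml; apply: ler_sum => i _.
rewrite mulr_sumr; apply: ler_sum => j _.
by have := sqr_ge0 (a i - a j); lra.
Qed.

Section pareto_square_integrable.
Context (R : realType) (lambda : R) (l1 : 1 < lambda) (l3 : 3 < lambda).

Lemma pareto_second_moment_lty :
  (\int[pareto_probability l1]_x (x ^+ 2)%:E < +oo)%E.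
Proof.
have := @pareto_second_moment_tail R lambda l1 1 l3 (lexx 1).
rewrite !ge0_integral_pareto//.
- move=> tail; apply: le_lt_trans (ltry (((lambda - 1) / (lambda - 3) * 1 `^ (3 - lambda)))).
  rewrite -tail le_eqVlt; apply/predU1P; left; apply: eq_integral => x x1.
  by rewrite indicE x1 mulr1.
- exact/measurable_EFinP/measurable_funX.
- by move=> x; rewrite lee_fin sqr_ge0.
- by apply/measurable_EFinP; apply: measurable_funM => //; exact: measurable_funX.
- by move=> x; rewrite lee_fin mulr_ge0// sqr_ge0.
Qed.

(** [f] grows at most linearly away from the origin, so its square is dominated by a constant plus a
    multiple of the sum of the squared coordinates, which is integrable since lambda > 3. *)
Lemma lip1_sqr_integrable n L (f : n.-tuple R -> R) : lip1 L f ->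
  (\int[pareto_power l1 n]_x (f x ^+ 2)%:E < +oo)%E.
Proof.
move=> fL.
pose z : n.-tuple R := [tuple 0 | i < n].
pose C := 2 * L ^+ 2 * n%:R.
have C0 : 0 <= C by rewrite mulr_ge0// mulr_ge0// sqr_ge0.
have fle x : f x ^+ 2 <= 2 * f z ^+ 2 + C * \sum_(i < n) tnth x i ^+ 2.
  have d2 : dist1 x z ^+ 2 <= n%:R * \sum_(i < n) tnth x i ^+ 2.
    rewrite (le_trans (sqr_sum_le _))// ler_wpM2l//; apply: ler_sum => i _.
    by rewrite tnth_mktuple subr0 real_normK ?num_real.
  have fd : (f x - f z) ^+ 2 <= L ^+ 2 * dist1 x z ^+ 2.
    rewrite -real_normK ?num_real// -exprMn lerXn2r ?nnegrE//.
    exact: le_trans (fL x z).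
  have fn : L ^+ 2 * dist1 x z ^+ 2 <= L ^+ 2 * (n%:R * \sum_(i < n) tnth x i ^+ 2).
    by rewrite ler_wpM2l// sqr_ge0.
  (* This square is 2 (f z)^2 + 2 (f x - f z)^2 - (f x)^2. *)
  have := sqr_ge0 (f x - 2 * f z); rewrite /C; lra.
have mx2 : measurable_fun [set: n.-tuple (measurableTypeR R)]
    (fun x => \sum_(i < n) (tnth x i ^+ 2)%:E)%E.
  apply: emeasurable_sum => i; apply/measurable_EFinP/measurable_funX.
  exact: measurable_tnth.
have s0 (x : n.-tuple R) : (0 <= \sum_(i < n) (tnth x i ^+ 2)%:E)%E.
  by apply: sume_ge0 => i _; rewrite lee_fin sqr_ge0.
apply: (@le_lt_trans _ _ (\int[pareto_power l1 n]_x
    ((2 * f z ^+ 2)%:E + C%:E * \sum_(i < n) (tnth x i ^+ 2)%:E))%E).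
  apply: ge0_le_integral => //.
  - by move=> x _; rewrite lee_fin sqr_ge0.
  - by apply/measurable_EFinP/measurable_funX; exact: (lip1_measurable fL).
  - by apply: emeasurable_funD => //; exact: emeasurable_funM.
  - by move=> x _; rewrite sumEFin -EFinM -EFinD lee_fin.
rewrite ge0_integralD//.
- rewrite integral_probability_cst ge0_integralZl//.
  rewrite (@integral_sum_tnth _ _ _ _ n (fun x : measurableTypeR R => (x ^+ 2)%:E)).
  - rewrite lte_add_pinfty ?ltry// lte_mul_pinfty ?lee_fin// lte_mul_pinfty ?lee_fin//.
    exact: pareto_second_moment_lty.
  - exact/measurable_EFinP/measurable_funX.
  - by move=> x; rewrite lee_fin sqr_ge0.
- by move=> x _; rewrite lee_fin mulr_ge0// sqr_ge0.
- by move=> x _; rewrite mule_ge0 ?lee_fin.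
- exact: emeasurable_funM.
Qed.

End pareto_square_integrable.

Section bounded_Rintegral.
Context d (T : measurableType d) (R : realType) (P : probability T R).

Lemma normr_Rintegral_le (f : T -> R) (M : R) : P.-integrable [set: T] (EFin \o f) ->
  (forall x, `|f x| <= M) -> `|\int[P]_x f x| <= M.
Proof.
move=> fi fM; rewrite (le_trans (le_normr_Rintegral measurableT fi))//.
rewrite (_ : M = \int[P]_(x in [set: T]) (cst M x)).
  apply: le_Rintegral => //.
    exact: (integrable_norm fi).
  exact: finite_measure_integrable_cst.
by rewrite Rintegral_cst//= probability_setT mulr1.
Qed.

End bounded_Rintegral.

Section cons_tuple.
Context {R : realType} {n : nat}.
Implicit Types (x y : R) (t s : n.-tuple R).

Lemma dist1_cons x y t s :
  dist1 [tuple of x :: t] [tuple of y :: s] = `|x - y| + dist1 t s.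
Proof.
rewrite /dist1 big_ord_recl !tnth0; congr (_ + _).
by apply: eq_bigr => i _; rewrite !tnthS.
Qed.

Lemma tshift_cons0 a x t :
  tshift ord0 a [tuple of x :: t] = [tuple of (x + a) :: t].
Proof.
apply: eq_from_tnth => i; rewrite tnth_mktuple.
by case: (unliftP ord0 i) => [j|] ->; rewrite ?tnth0 ?eqxx// !tnthS /= addr0.
Qed.

Lemma tshift_consS i a x t :
  tshift (lift ord0 i) a [tuple of x :: t] = [tuple of x :: tshift i a t].
Proof.
apply: eq_from_tnth => j; rewrite tnth_mktuple.
case: (unliftP ord0 j) => [k|] ->; rewrite ?tnth0 ?addr0//.
by rewrite !tnthS tnth_mktuple (inj_eq lift_inj).
Qed.

Lemma lip1_section L (f : n.+1.-tuple R -> R) (x : R) : lip1 L f ->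
  lip1 L (fun t => f [tuple of x :: t]).
Proof.
by move=> fL t s; rewrite (le_trans (fL _ _))// dist1_cons subrr normr0 add0r.
Qed.

End cons_tuple.

(** * Tensorization of the Poincare inequality *)

Section poincare.
Context {R : realType} (lambda : R) (l1 : 1 < lambda) (l3 : 3 < lambda).

Lemma lip1_integrable n L (f : n.-tuple R -> R) : lip1 L f ->
  (pareto_power l1 n).-integrable setT (EFin \o f).
Proof.
move=> fL; apply: sqr_integrable_integrable; first exact: lip1_measurable fL.
exact: (lip1_sqr_integrable l1 l3 fL).
Qed.

Lemma section_mean_lip n L (f : n.+1.-tuple R -> R) (x y : R) : lip1 L f ->
  `|\int[pareto_power l1 n]_t f [tuple of x :: t]
    - \int[pareto_power l1 n]_t f [tuple of y :: t]| <= L * `|x - y|.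
Proof.
move=> fL; have fi z := lip1_integrable (lip1_section z fL).
rewrite -RintegralB//; apply: normr_Rintegral_le.
  exact: (integrableB measurableT (fi x) (fi y)).
move=> t; rewrite (le_trans (fL _ _))// dist1_cons [dist1 t t]big1 ?addr0//.
by move=> i _; rewrite subrr normr0.
Qed.

(** The Taylor error is bounded uniformly in the remaining coordinates, so integrating it over a
    probability measure keeps the same constant: the mean of [p] is the derivative of the mean of
    [f]. *)
Lemma section_mean_partial n L (f p : n.+1.-tuple R -> R) (x a : R) :
  lip1 L f -> lip1 L p -> partial_with L ord0 f p ->
  `|\int[pareto_power l1 n]_t f [tuple of (x + a : R) :: t]
    - \int[pareto_power l1 n]_t f [tuple of x :: t]
    - a * \int[pareto_power l1 n]_t p [tuple of x :: t]| <= L * a ^+ 2.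
Proof.
move=> fL pL fp; have fi z := lip1_integrable (lip1_section z fL).
have pi := lip1_integrable (lip1_section x pL).
have pai : (pareto_power l1 n).-integrable setT
    (EFin \o (fun t : n.-tuple R => a * p [tuple of x :: t])).
  exact: (integrableZl measurableT a pi).
have fxi := integrableB measurableT (fi (x + a)) (fi x).
rewrite -RintegralB// -RintegralZl// -RintegralB//.
apply: normr_Rintegral_le; first exact: (integrableB measurableT fxi pai).
by move=> t; have := fp [tuple of x :: t] a; rewrite tshift_cons0.
Qed.

Lemma poincare_power n L (f : n.-tuple R -> R) (p : 'I_n -> n.-tuple R -> R) :
  0 <= L -> lip1 L f -> (forall i, lip1 L (p i)) ->
  (forall i, partial_with L i f (p i)) ->
  (\int[pareto_power l1 n]_x ((f x - fine (\int[pareto_power l1 n]_x (f x)%:E)) ^+ 2)%:E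
   <= (4 / (lambda - 1) ^+ 2)%:E *
      \int[pareto_power l1 n]_x (\sum_(i < n) (tnth x i ^+ 2 * p i x ^+ 2)%:E))%E.
Proof.
set K := 4 / _; have K0 : 0 <= K by rewrite divr_ge0// sqr_ge0.
elim: n f p => [|n IH] f p L0 fL pL fp.
  have f0 x : f x = f [tuple] by rewrite (tuple0 x).
  rewrite [X in fine X](_ : _ = (f [tuple])%:E); last first.
    by under eq_integral do rewrite f0; rewrite integral_probability_cst.
  under eq_integral do rewrite f0 subrr expr0n/=.
  rewrite integral0 mule_ge0 ?lee_fin//; apply: integral_ge0 => x _.
  by rewrite big_ord0.
pose P := pareto_probability l1; pose Q := pareto_power l1 n.
(* Split the variance of f into that of its sections f(x, .), bounded by the
   induction hypothesis, and that of their means c(x). *)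
pose c x := \int[Q]_t f [tuple of x :: t].
pose q x := \int[Q]_t p ord0 [tuple of x :: t].
have cq : continuous q.
  by apply: (@lip_continuous _ L) => x y; exact: section_mean_lip.
have cc : continuous c.
  by apply: (@lip_continuous _ L) => x y; exact: section_mean_lip.
have mf := lip1_measurable fL.
have mfC : measurable_fun [set: n.+1.-tuple (measurableTypeR R)]
    (fun z => ((f z - c 1) ^+ 2)%:E).
  by apply/measurable_EFinP/measurable_funX/measurable_funB.
have mterm i : measurable_fun [set: n.+1.-tuple (measurableTypeR R)]
    (fun z => (tnth z i ^+ 2 * p i z ^+ 2)%:E).
  apply/measurable_EFinP/measurable_funM; apply: measurable_funX.
    exact: measurable_tnth.
  exact: lip1_measurable (pL i).
have term0 i (z : n.+1.-tuple R) : (0 <= (tnth z i ^+ 2 * p i z ^+ 2)%:E)%E.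
  by rewrite lee_fin mulr_ge0// sqr_ge0.
pose S (z : n.+1.-tuple R) := (\sum_(i < n)
  (tnth z (lift ord0 i) ^+ 2 * p (lift ord0 i) z ^+ 2)%:E)%E.
have mS : measurable_fun [set: n.+1.-tuple (measurableTypeR R)] S.
  exact: emeasurable_sum.
have S0 z : (0 <= S z)%E by exact: sume_ge0.
(* The centre is moved from the mean of [f] to c 1, where [weighted_poincare] centres the function
   c. *)
rewrite (le_trans _ (_ : (\int[pareto_power l1 n.+1]_z ((f z - c 1) ^+ 2)%:E <= _)%E))//.
  rewrite [leRHS]bias_variance//; last exact: (lip1_sqr_integrable l1 l3 fL).
  by rewrite leeDl// lee_fin sqr_ge0.
rewrite [leLHS]ge0_integral_power//; last by move=> x; rewrite lee_fin sqr_ge0.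
have mSQ := measurable_power_section P mS S0.
have mcC : measurable_fun [set: R] (fun x => ((c x - c 1) ^+ 2)%:E).
  apply/measurable_EFinP/measurable_funX; apply: measurable_funB => //.
  exact: continuous_measurable_fun.
apply: (@le_trans _ _ (\int[P]_x
    (K%:E * \int[Q]_t S [tuple of x :: t] + ((c x - c 1) ^+ 2)%:E))%E).
  apply: ge0_le_integral => //.
  - by move=> x _; apply: integral_ge0 => t _; rewrite lee_fin sqr_ge0.
  - by apply: (measurable_power_section P mfC) => z; rewrite lee_fin sqr_ge0.
  - by apply: emeasurable_funD => //; exact: emeasurable_funM.
  move=> x _; have fxL := lip1_section x fL.
  rewrite [leLHS](bias_variance _ (lip1_measurable fxL)); last first.
    exact: (lip1_sqr_integrable l1 l3 fxL).
  rewrite leeD2r//.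
  apply: le_trans (IH _ (fun i t => p (lift ord0 i) [tuple of x :: t]) L0 fxL _ _) _.
  - by move=> i; exact: lip1_section.
  - by move=> i t a; rewrite -tshift_consS; exact: fp.
  - rewrite le_eqVlt; apply/predU1P; left; congr (_ * _)%E.
    by apply: eq_integral => t _; apply: eq_bigr => i _; rewrite tnthS.
rewrite ge0_integralD//; last 3 first.
- by move=> x _; rewrite mule_ge0 ?lee_fin//; exact: integral_ge0.
- exact: emeasurable_funM.
- by move=> x _; rewrite lee_fin sqr_ge0.
rewrite ge0_integralZl//; last by move=> x _; exact: integral_ge0.
pose S1 (z : n.+1.-tuple R) := (tnth z ord0 ^+ 2 * p ord0 z ^+ 2)%:E.
have mS1 : measurable_fun [set: n.+1.-tuple (measurableTypeR R)] S1 by exact: mterm.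
have S10 z : (0 <= S1 z)%E by exact: term0.
rewrite [X in (_ <= _ * X)%E](_ : _ = (\int[pareto_power l1 n.+1]_z S z +
    \int[pareto_power l1 n.+1]_z S1 z))%E; last first.
  rewrite -ge0_integralD//; apply: eq_integral => z _.
  by rewrite big_ord_recl addeC.
rewrite [leRHS]ge0_muleDr; [|by apply: integral_ge0..].
rewrite [X in (_ <= _ * X + _)%E]ge0_integral_power// leeD2l//.
apply: le_trans (weighted_poincare l1 cq _) _.
  by move=> x a; exact: section_mean_partial.
rewrite lee_wpmul2l ?lee_fin// [leRHS]ge0_integral_power//.
apply: ge0_le_integral => //.
- by move=> x _; rewrite lee_fin mulr_ge0// sqr_ge0.
- apply/measurable_EFinP/measurable_funM; apply: measurable_funX => //.
  exact: continuous_measurable_fun.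
- exact: (measurable_power_section P mS1 S10).
move=> x _; have p0L := lip1_section x (pL ord0).
rewrite /S1 [leRHS](_ : _ = (x ^+ 2)%:E *
    \int[Q]_t (p ord0 [tuple of x :: t] ^+ 2)%:E)%E; last first.
  rewrite -ge0_integralZl//.
  - by apply/measurable_EFinP/measurable_funX; exact: lip1_measurable p0L.
  - by move=> t _; rewrite lee_fin sqr_ge0.
  - by rewrite lee_fin sqr_ge0.
rewrite EFinM lee_wpmul2l ?lee_fin ?sqr_ge0//.
(* Jensen: the squared mean (q x)^2 is at most the mean of the squares of the partial derivative
   over the section at x. *)
have := bias_variance 0 (lip1_measurable p0L) (lip1_sqr_integrable l1 l3 p0L).
rewrite /= subr0; under eq_integral do rewrite subr0.
by move=> ->; rewrite leeDr//; apply: integral_ge0 => t _; rewrite lee_fin sqr_ge0.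
Qed.

End poincare.

(** * The upper bound *)

Lemma variance_integral {d} {T : measurableType d} {R : realType}
    (P : probability T R) (X : T -> R) :
  ('V_P[X] = \int[P]_x ((X x - fine (\int[P]_x (X x)%:E)) ^+ 2)%:E)%E.
Proof.
by rewrite /variance covariance.unlock expectation.unlock; apply: eq_integral.
Qed.

Section upper_bound.
Context {R : realType} (lambda : R) (l1 : 1 < lambda) (l3 : 3 < lambda).
Notation P := (pareto_probability l1).
Let al := lambda - 1.
Let al0 : 0 < al. Proof. by rewrite subr_gt0. Qed.

(* The complement of [0, t[ differs from [t, +oo[ by negative numbers only: with
   it the splitting at t holds at every point of the space. *)
Lemma second_moment_outside (t : R) : 1 <= t ->
  (\int[P]_x (x ^+ 2 * \1_(~` `[0%R, t[%classic) x)%:E =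
   ((lambda - 1) / (lambda - 3) * t `^ (3 - lambda))%:E)%E.
Proof.
move=> t1; rewrite -(pareto_second_moment_tail l1 l3 t1) !ge0_integral_pareto//.
- apply: eq_integral => x; rewrite inE/= in_itv/= andbT => x1.
  rewrite !indicE; congr ((_ * _%:R)%:E * _)%E.
  rewrite in_setC !mem_setE !in_itv/= andbT (le_trans ler01 x1)/=.
  by rewrite -leNgt.
- apply/measurable_EFinP/measurable_funM => //; exact: measurable_funX.
- by move=> x; rewrite lee_fin mulr_ge0// sqr_ge0.
- apply/measurable_EFinP/measurable_funM => //.
  by apply: measurable_indic; exact: measurableC.
- by move=> x; rewrite lee_fin mulr_ge0// sqr_ge0.
Qed.

(** Write N for the number of coordinates. The choice t^(lambda - 1) = N turns N t^(3 - lambda) into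
    t^2, so the two parts of the splitting add up to (1 + (lambda - 1) / (lambda - 3)) t^2. *)
Lemma integral_weighted_gradient n (p : 'I_n.+1 -> n.+1.-tuple R -> R) :
  (forall i, measurable_fun [set: n.+1.-tuple (measurableTypeR R)] (p i)) ->
  (forall x, \sum_i p i x ^+ 2 <= 1) ->
  (\int[pareto_power l1 n.+1]_x (\sum_(i < n.+1) (tnth x i ^+ 2 * p i x ^+ 2)%:E) <=
   (2 * (lambda - 2) / (lambda - 3) * n.+1%:R `^ (2 / (lambda - 1)))%:E)%E.
Proof.
move=> mp p1; pose t : R := n.+1%:R `^ al^-1.
have t1 : 1 <= t.
  apply: (@le_trans _ _ (1 `^ al^-1)); first by rewrite powR1.
  by rewrite ge0_ler_powR ?nnegrE ?invr_ge0 ?(ltW al0)// ler1n.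
have t0 : 0 < t by exact: lt_le_trans t1.
pose h (x : R) := x ^+ 2 * \1_(~` `[0%R, t[%classic) x.
have mh : measurable_fun [set: measurableTypeR R] (fun x => (h x)%:E).
  apply/measurable_EFinP/measurable_funM => //.
  by apply: measurable_indic; exact: measurableC.
have h0 x : (0 <= (h x)%:E)%E by rewrite lee_fin mulr_ge0// sqr_ge0.
have msum : measurable_fun [set: n.+1.-tuple (measurableTypeR R)]
    (fun x => \sum_(i < n.+1) (h (tnth x i))%:E)%E.
  by apply: emeasurable_sum => i; apply: (measurableT_comp mh); exact: measurable_tnth.
apply: (@le_trans _ _ (\int[pareto_power l1 n.+1]_x
    ((t ^+ 2)%:E + \sum_(i < n.+1) (h (tnth x i))%:E))%E).
  apply: ge0_le_integral => //.
  - by move=> x _; apply: sume_ge0 => i _; rewrite lee_fin mulr_ge0// sqr_ge0.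
  - apply: emeasurable_sum => i; apply/measurable_EFinP/measurable_funM.
      by apply: measurable_funX; exact: measurable_tnth.
    exact: measurable_funX.
  - exact: emeasurable_funD.
  move=> x _; rewrite !sumEFin -EFinD lee_fin.
  apply: (@le_trans _ _ (\sum_(i < n.+1) (t ^+ 2 * p i x ^+ 2 + h (tnth x i)))).
    apply: ler_sum => i _; rewrite /h indicE.
    have pi1 : p i x ^+ 2 <= 1.
      by apply: le_trans (p1 x); rewrite (bigD1 i)//= lerDl sumr_ge0// => j _; exact: sqr_ge0.
    case: (boolP (tnth x i \in _)) => [_|].
      rewrite mulr1 -[leLHS]add0r lerD//.
        by apply: mulr_ge0; exact: sqr_ge0.
      by rewrite ler_piMr// sqr_ge0.
    rewrite notin_setE/= => /contrapT; rewrite in_itv/= => /andP[x0 xt].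
    by rewrite mulr0 addr0 ler_wpM2r ?sqr_ge0// lerXn2r ?nnegrE// ltW.
  rewrite big_split/= lerD2r -mulr_sumr ler_piMr ?sqr_ge0//.
rewrite ge0_integralD//; last 2 first.
- by move=> x _; rewrite lee_fin sqr_ge0.
- by move=> x _; exact: sume_ge0.
rewrite integral_probability_cst.
rewrite (@integral_sum_tnth _ _ _ P n.+1 (fun x : measurableTypeR R => (h x)%:E))//.
rewrite second_moment_outside// -EFinM -EFinD lee_fin.
have -> : t ^+ 2 = n.+1%:R `^ (2 / al).
  by rewrite -powR_mulrn ?(ltW t0)// /t -powRrM mulrC.
have -> : t `^ (3 - lambda) = n.+1%:R `^ (2 / al) / n.+1%:R.
  rewrite /t -powRrM -[X in _ = _ / X]powRr1// -powRB ?pnatr_eq0 ?implybT//.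
  by congr (_ `^ _); rewrite /al; field; rewrite gt_eqF.
set N := _ `^ _; rewrite le_eqVlt; apply/predU1P; left.
by field; rewrite [1 + _]addrC natr1 pnatr_eq0/= gt_eqF// subr_gt0.
Qed.

Lemma variance_Lip1_le n (f : n.-tuple R -> R) : Lip1 n f ->
  ('V_(pareto_power l1 n)[f] <=
   (16 * (lambda - 2) / ((lambda - 1) ^+ 2 * (lambda - 3)) *
    n%:R `^ (2 / (lambda - 1)))%:E)%E.
Proof.
move=> fL; have fL1 := Lip1_lip1 fL; rewrite variance_integral.
case: n f fL fL1 => [|n] f fL fL1.
  (* For n = 0 the claimed bound is 0, as 0 to a nonzero power is 0; the Poincare inequality gives
     exactly that, its sum being empty. *)
  apply: le_trans (@poincare_power R lambda l1 l3 0 1 f (fun _ _ => 0) ler01 fL1 _ _) _.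
  - by case.
  - by case.
  - under eq_integral do rewrite big_ord0.
    by rewrite integral0 mule0 powR0 ?mulr0// mulf_neq0// ?invr_eq0 gt_eqF.
pose M := 2 * (lambda - 2) / (lambda - 3) * n.+1%:R `^ (2 / (lambda - 1)).
set K0 := 4 / (lambda - 1) ^+ 2.
rewrite [leRHS](_ : _ = (2 * (K0 * M))%:E); last first.
  by congr EFin; rewrite /M /K0; field; rewrite !gt_eqF// subr_gt0.
apply/lee_addgt0Pr => e e0.
(* d <= 1 gives d^2 <= d, so the other bound on d suffices to keep twice the squared approximation
   error below e. *)
pose d := Num.min 1 (e / (2 * n.+1%:R ^+ 2)).
have d0 : 0 < d by rewrite lt_min ltr01 divr_gt0// mulr_gt0// exprn_gt0.
have d1 : d <= 1 by rewrite ge_min lexx.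
have de : 2 * (n.+1%:R * d) ^+ 2 <= e.
  have : d <= e / (2 * n.+1%:R ^+ 2) by rewrite ge_min lexx orbT.
  rewrite ler_pdivlMr ?mulr_gt0 ?exprn_gt0// => /(le_trans _); apply.
  rewrite exprMn mulrA [leRHS]mulrC ler_wpM2l//.
  by rewrite expr2 ger_pMl.
have [g [p [L [gL gf L0 gp]]]] := smooth_approximation d0 fL.
have pL i := (gp i).1; have gP i := (gp i).2.
have gL1 := Lip1_lip1 gL.
(* [poincare_power] takes a single constant for [g] and its partial derivatives; L + 1 dominates
   both 1 and L. *)
have glip : lip1 (L + 1) g by apply: lip1W gL1; rewrite lerDr.
have plip i : lip1 (L + 1) (p i) by apply: lip1W (pL i); rewrite lerDl.
have gpart i : partial_with (L + 1) i g (p i).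
  by apply: partial_withW (gP i); rewrite lerDl.
pose m := fine (\int[pareto_power l1 n.+1]_x (g x)%:E).
have mg := lip1_measurable gL1; have mf := lip1_measurable fL1.
have hg : (\int[pareto_power l1 n.+1]_x ((g x - m) ^+ 2)%:E <= (K0 * M)%:E)%E.
  apply: le_trans (poincare_power l1 l3 (addr_ge0 L0 ler01) glip plip gpart) _.
  rewrite [leRHS]EFinM lee_wpmul2l ?lee_fin ?divr_ge0 ?sqr_ge0//.
  apply: integral_weighted_gradient => [i|x]; first exact: lip1_measurable (pL i).
  exact: Lip1_gradient_le1 L0 pL gP gL.
rewrite (le_trans _ (_ : (\int[pareto_power l1 n.+1]_x ((f x - m) ^+ 2)%:E <= _)%E))//.
  rewrite [leRHS]bias_variance//; last exact: (lip1_sqr_integrable l1 l3 fL1).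
  by rewrite leeDl// lee_fin sqr_ge0.
apply: (@le_trans _ _ (\int[pareto_power l1 n.+1]_x
    (2%:E * ((g x - m) ^+ 2)%:E + (2 * (n.+1%:R * d) ^+ 2)%:E))%E).
  apply: ge0_le_integral => //.
  - by move=> x _; rewrite lee_fin sqr_ge0.
  - by apply/measurable_EFinP/measurable_funX/measurable_funB.
  - apply: emeasurable_funD => //; apply: emeasurable_funM => //.
    by apply/measurable_EFinP/measurable_funX/measurable_funB.
  move=> x _; rewrite -EFinM -EFinD lee_fin.
  have : (g x - f x) ^+ 2 <= (n.+1%:R * d) ^+ 2.
    by rewrite -real_normK ?num_real// lerXn2r ?nnegrE ?mulr_ge0// ltW.
  (* This square is 2 (g x - m)^2 + 2 (g x - f x)^2 - (f x - m)^2; the factor 2 in the final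
     constant originates here. *)
  by have := sqr_ge0 (2 * (g x) - f x - m); lra.
rewrite ge0_integralD//; last 3 first.
- by move=> x _; rewrite mule_ge0 ?lee_fin// sqr_ge0.
- apply: emeasurable_funM => //.
  by apply/measurable_EFinP/measurable_funX/measurable_funB.
- by move=> x _; rewrite lee_fin mulr_ge0// sqr_ge0.
rewrite ge0_integralZl//; last 2 first.
- by apply/measurable_EFinP/measurable_funX/measurable_funB.
- by move=> x _; rewrite lee_fin sqr_ge0.
rewrite integral_probability_cst [(2 * (K0 * M))%:E]EFinM leeD ?lee_fin//.
by rewrite lee_wpmul2l.
Qed.

End upper_bound.

(** * The lower bound *)

Section maximum.
Context {R : realType} {n : nat}.
Implicit Types x y : n.-tuple R.

(** The base value 0 is invisible on the support of the measure when n > 0, where coordinates are at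
    least 1, and it keeps the function 1-Lipschitz on the whole space. *)
Definition tuple_max x : R := \big[Num.max/0]_(i < n) tnth x i.

Lemma le_tuple_max x i : tnth x i <= tuple_max x.
Proof. exact: le_bigmax. Qed.

Lemma tuple_max_Lip1 : Lip1 n tuple_max.
Proof.
have dle x y i : `|tnth x i - tnth y i| <= euclidean_dist x y.
  rewrite -sqrtr_sqr ler_wsqrtr// (bigD1 i)//= lerDl.
  by apply: sumr_ge0 => j _; exact: sqr_ge0.
have half x y : tuple_max x <= tuple_max y + euclidean_dist x y.
  apply: bigmax_le => [|i _].
    by rewrite addr_ge0 ?sqrtr_ge0//; exact: bigmax_ge_id.
  have /ler_normlP[_ xy] := dle x y i.
  by have := le_tuple_max y i; lra.
have dC x y : euclidean_dist x y = euclidean_dist y x.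
  by congr Num.sqrt; apply: eq_bigr => i _; rewrite -sqrrN opprB.
move=> x y; apply/ler_normlP; split; have := half x y; have := half y x.
  by rewrite dC; lra.
by lra.
Qed.

End maximum.

Lemma bernoulli_ge {R : realType} n (x : R) : 0 <= x <= 1 ->
  1 - n%:R * x <= (1 - x) ^+ n.
Proof.
move=> /andP[x0 x1]; elim: n => [|n IH]; first by rewrite mul0r subr0 expr0.
have n0 : (0 : R) <= n%:R by [].
rewrite exprS -natr1; apply: (@le_trans _ _ ((1 - x) * (1 - n%:R * x))).
  by have := mulr_ge0 n0 (sqr_ge0 x); move: (n%:R) => N; nra.
by rewrite ler_wpM2l ?subr_ge0.
Qed.

(** A rational substitute for (1 - x)^n <= exp (- n x); the induction step is (1 - x) (1 + (n + 1)
    x) <= 1 + n x. *)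
Lemma bernoulli_le {R : realType} n (x : R) : 0 <= x <= 1 ->
  (1 - x) ^+ n * (1 + n%:R * x) <= 1.
Proof.
move=> /andP[x0 x1]; elim: n => [|n IH]; first by rewrite expr0 mul0r addr0 mulr1.
have n0 : (0 : R) <= n%:R by [].
apply: le_trans IH; rewrite exprSr -mulrA ler_wpM2l ?exprn_ge0 ?subr_ge0//.
rewrite -natr1; have := mulr_ge0 n0 (sqr_ge0 x); move: (n%:R) n0 => N N0 h; nra.
Qed.

Section lower_bound.
Context {R : realType} (lambda : R) (l1 : 1 < lambda).

Lemma second_moment_ge {d} {T : measurableType d} (P : probability T R)
    (X : T -> R) (S : set T) (m dl : R) :
  measurable S -> measurable_fun [set: T] X -> 0 <= dl ->
  (forall x, S x -> dl <= `|X x - m|) ->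
  ((dl ^+ 2)%:E * P S <= \int[P]_x ((X x - m) ^+ 2)%:E)%E.
Proof.
move=> mS mX dl0 Xm; rewrite -integral_cst//.
have mXm : measurable_fun [set: T] (fun x => ((X x - m) ^+ 2)%:E).
  by apply/measurable_EFinP/measurable_funX/measurable_funB.
apply: (@le_trans _ _ (\int[P]_(x in S) ((X x - m) ^+ 2)%:E)%E).
  apply: ge0_le_integral => //.
  - by move=> x _; rewrite lee_fin sqr_ge0.
  - exact: measurable_funTS.
  - move=> x Sx; rewrite lee_fin -[leRHS]real_normK ?num_real//.
    by rewrite lerXn2r ?nnegrE// Xm.
by apply: ge0_subset_integral => // x _; rewrite lee_fin sqr_ge0.
Qed.

(** Wherever the mean lies relative to the midpoint of [a, b], [X] stays at distance at least (b -
    a) / 2 from it on one of the two events. *)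
Lemma variance_ge_gap {d} {T : measurableType d} (P : probability T R)
    (X : T -> R) (A B : set T) (a b q : R) :
  measurable A -> measurable B -> measurable_fun [set: T] X -> a <= b ->
  (forall x, A x -> X x <= a) -> (forall x, B x -> b <= X x) ->
  (q%:E <= P A)%E -> (q%:E <= P B)%E ->
  ((((b - a) / 2) ^+ 2 * q)%:E <= 'V_P[X])%E.
Proof.
move=> mA mB mX ab XA XB qA qB; rewrite variance_integral; set m := fine _.
have dl0 : 0 <= (b - a) / 2 by rewrite divr_ge0// subr_ge0.
have [mab|mab] := leP ((a + b) / 2) m.
- apply: le_trans (second_moment_ge P mA mX dl0 _).
    by rewrite EFinM lee_wpmul2l// lee_fin sqr_ge0.
  by move=> x /XA Xa; rewrite ler_normr; apply/orP; right; lra.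
- apply: le_trans (second_moment_ge P mB mX dl0 _).
    by rewrite EFinM lee_wpmul2l// lee_fin sqr_ge0.
  by move=> x /XB Xb; rewrite ler_normr; apply/orP; left; lra.
Qed.

Lemma pareto_power_below n (s : R) : 1 <= s ->
  pareto_power l1 n [set x | forall i, `]-oo, s[%classic (tnth x i)] =
  ((1 - s `^ (1 - lambda)) ^+ n)%:E.
Proof.
move=> s1; rewrite [LHS](power_probability_box (pareto_probability l1)
  (A := fun=> `]-oo, s[%classic))//.
rewrite (eq_bigr (fun=> (1 - s `^ (1 - lambda))%:E)); last first.
  move=> i _; rewrite -setCitvr probability_setC//.
  by rewrite [X in (_ - X)%E]pareto_tail.
by rewrite prodEFin prodr_const card_ord.
Qed.

Lemma variance_tuple_max_ge n : (0 < n)%N ->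
  ((((4 `^ (lambda - 1)^-1 - 2 `^ (lambda - 1)^-1) / 2) ^+ 2 / 5
    * n%:R `^ (2 / (lambda - 1)))%:E
  <= 'V_(pareto_power l1 n)[tuple_max])%E.
Proof.
move=> n0; set al := lambda - 1.
have al0 : 0 < al by rewrite subr_gt0.
have N0 : (0 : R) < n%:R by rewrite ltr0n.
(* The level that a single coordinate exceeds with probability 1 / (k n). Both s 2 and s 4 are of
   order n^(1 / al), and so is their gap. *)
pose s (k : R) := (k * n%:R) `^ al^-1.
have N1 : (1 : R) <= n%:R by rewrite ler1n.
have kN (k : R) : 1 <= k -> 1 <= k * n%:R by move=> k1; exact: mulr_ege1.
have s1 (k : R) : 1 <= k -> 1 <= s k.
  move=> k1; apply: (@le_trans _ _ (1 `^ al^-1)); first by rewrite powR1.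
  by rewrite ge0_ler_powR ?nnegrE ?invr_ge0 ?(ltW al0) ?kN// (le_trans _ (kN k k1)).
have sE (k : R) : 1 <= k -> s k `^ (1 - lambda) = (k * n%:R)^-1.
  move=> k1; rewrite /s -powRrM -[1 - lambda]opprB mulrN mulVf ?gt_eqF//.
  by rewrite powR_inv1// (le_trans _ (kN k k1)).
pose below t := [set x : n.-tuple (measurableTypeR R) | forall i, `]-oo, t[%classic (tnth x i)].
have mbelow t : measurable (below t).
  rewrite (_ : below t =
      \bigcap_(i in [set: 'I_n]) ((@tnth n R)^~ i @^-1` `]-oo, t[%classic)).
    apply: fin_bigcap_measurable => [|i _]; first exact: finite_finset.
    by rewrite -[X in measurable X]setTI; exact: measurable_tnth.
  by apply/seteqP; split=> x /= h i => [_|]; [exact: h|exact: (h i Logic.I)].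
have inv01 (k : R) : 1 <= k -> 0 <= (k * n%:R)^-1 <= 1.
  move=> /kN k1; have k0 : 0 < k * n%:R by exact: lt_le_trans k1.
  by rewrite invr_ge0 (ltW k0) invf_le1.
have le12 : 1 <= 2 :> R by rewrite ler1n.
have le14 : 1 <= 4 :> R by rewrite ler1n.
have s24 : s 2 <= s 4.
  by rewrite ge0_ler_powR ?nnegrE ?invr_ge0 ?(ltW al0) ?mulr_ge0// ler_wpM2r// ler_nat.
have -> : ((4 `^ al^-1 - 2 `^ al^-1) / 2) ^+ 2 / 5 * n%:R `^ (2 / al) =
    ((s 4 - s 2) / 2) ^+ 2 * 5^-1.
  rewrite /s !powRM// -mulrBl [2 / al]mulrC powRrM powR_mulrn ?powR_ge0//.
  by field.
apply: (@variance_ge_gap _ _ (pareto_power l1 n) tuple_max (below (s 2))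
  (~` below (s 4))) => //.
- exact: measurableC.
- exact: lip1_measurable (Lip1_lip1 tuple_max_Lip1).
- move=> x xs; apply: bigmax_le => [|i _].
    by rewrite (le_trans ler01)// s1.
  by have := xs i; rewrite /= in_itv/= => /ltW.
- move=> x /existsNP[i]; rewrite /= in_itv/= => /negP; rewrite -leNgt => sx.
  exact: le_trans sx (le_tuple_max x i).
(* All coordinates lie below s 2 with probability (1 - 1 / (2 n))^n >= 1/2, more than the required
   1/5. *)
- rewrite pareto_power_below ?s1// lee_fin sE//.
  apply: le_trans (bernoulli_ge n (inv01 _ le12)).
  rewrite invfM mulrCA mulfV ?gt_eqF//; lra.
(* Here (1 - 1 / (4 n))^n <= 1 / (1 + 1/4) = 4/5, which is the origin of the 1/5. *)
- rewrite probability_setC// pareto_power_below ?s1// -EFinB lee_fin sE//.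
  have := bernoulli_le n (inv01 _ le14).
  rewrite invfM mulrCA mulfV ?gt_eqF// mulr1; lra.
Qed.

End lower_bound.

Theorem theorem1p6 (R : realType) (lambda : R) (hlambda : 3 < lambda) :
  (forall (n : nat) (f : n.-tuple R -> R), Lip1 n f ->
    ('V_(pareto_power (gt3_gt1 hlambda) n)[f] <=
     (pareto_constant lambda * n%:R `^ (2 / (lambda - 1)))%:E)%E) /\
  (fun n : nat => fine (sup_variance (gt3_gt1 hlambda) n))
    \is 'Theta_\oo(fun n : nat => n%:R `^ (2 / (lambda - 1))).
Proof.
have upper n (f : n.-tuple R -> R) : Lip1 n f ->
    ('V_(pareto_power (gt3_gt1 hlambda) n)[f] <=
     (pareto_constant lambda * n%:R `^ (2 / (lambda - 1)))%:E)%E.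
  move=> fL; apply: le_trans (variance_Lip1_le _ hlambda fL) _.
  by rewrite lee_fin ler_wpM2r ?powR_ge0// pareto_constant_ge.
split=> //; have l1 := gt3_gt1 hlambda.
have al0 : 0 < (lambda - 1)^-1 by rewrite invr_gt0 subr_gt0.
pose c := ((4 `^ (lambda - 1)^-1 - 2 `^ (lambda - 1)^-1) / 2) ^+ 2 / 5.
have c0 : 0 < c.
  rewrite divr_gt0// exprn_gt0// divr_gt0// subr_gt0.
  by rewrite gt0_ltr_powR ?nnegrE// ltr_nat.
have C0 : 0 < pareto_constant lambda.
  by rewrite !mulr_gt0// powR_gt0// ?divr_gt0// subr_gt0.
rewrite qualifE; apply/asboolP; exists (c, pareto_constant lambda); first by rewrite c0 C0.
exists 1%N => // n /= n0.
have supC : (sup_variance (gt3_gt1 hlambda) n <=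
    (pareto_constant lambda * n%:R `^ (2 / (lambda - 1)))%:E)%E.
  by apply: ge_ereal_sup => _ [f fL <-]; exact: upper.
have csup : ((c * n%:R `^ (2 / (lambda - 1)))%:E <=
    sup_variance (gt3_gt1 hlambda) n)%E.
  apply: le_trans (variance_tuple_max_ge (gt3_gt1 hlambda) n0) _.
  by apply: ereal_sup_ubound; exists tuple_max => //; exact: tuple_max_Lip1.
have pow0 : 0 <= n%:R `^ (2 / (lambda - 1)) :> R by rewrite powR_ge0.
have cn0 : 0 <= c * n%:R `^ (2 / (lambda - 1)) by rewrite mulr_ge0// ltW.
(* Finiteness, from the two bounds just proved, ensures that [fine] returns the actual supremum and
   not its default value 0. *)
have supfin : sup_variance (gt3_gt1 hlambda) n \is a fin_num.
  rewrite fin_numElt (lt_le_trans (ltNyr _) csup)/=.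
  exact: le_lt_trans supC (ltry _).
rewrite -(fineK supfin) !lee_fin in supC csup.
by rewrite (ger0_norm pow0) ger0_norm// (le_trans cn0).
Qed.
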